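(* There is a smooth ($C^\infty$) Anosov endomorphism $f:\mathbb{T}^3\to\mathbb{T}^3$ with weak and strong unstable exponents $\lambda^{wu}_f,\lambda^{su}_f$, conjugated with its linearization $A$ by a homeomorphism $h$ with $h\circ A=f\circ h$, such that, writing $\tilde m=h_*(m)$, the set $$Z=\{x\in\mathbb{T}^3:\ \lambda^{wu}_f(x)+\lambda^{su}_f(x)=\lambda^{wu}_f(\tilde m)+\lambda^{su}_f(\tilde m)\}$$ intersects some unstable leaf of $f$ in a set of positive Lebesgue measure of the leaf; moreover the conjugacy $h$ is absolutely continuous, but $h$ is not $C^1$, and in fact $h$ is not even Lipschitz.
   Context: $\mathbb{T}^3=\mathbb{R}^3/\mathbb{Z}^3$ and $m$ is Lebesgue (Haar) probability measure on $\mathbb{T}^3$. Anosov endomorphism: a $C^1$ local diffeomorphism $f:M\to M$ of a closed manifold such that along every full orbit $(x_n)_{n\in\mathbb{Z}}$ (i.e. $f(x_n)=x_{n+1}$) there is a $Df$-invariant splitting $T_{x_i}M=E^s_{x_i}\oplus E^u_{x_i}$, $i\in\mathbb{Z}$, with $Df$ uniformly contracting on $E^s$ and uniformly expanding on $E^u$. $f$ is special if $E^u_f(x)$ depends only on the point $x$ (not on the chosen orbit through $x$); then there is an unstable foliation tangent to $E^u_f$ whose leaves are the unstable leaves, each carrying the Lebesgue measure induced by its Riemannian metric. An Anosov endomorphism of a torus topologically conjugate to a linear one is special. Linearization of $f$: the unique linear endomorphism $A$ of $\mathbb{T}^3$ inducing the same homomorphism as $f$ on $\pi_1(\mathbb{T}^3)$.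 Weak and strong unstable exponents: here $A$ has a splitting $T\mathbb{T}^3=E^s_A\oplus E^{wu}_A\oplus E^{su}_A$ into one-dimensional bundles with $E^u_A=E^{wu}_A\oplus E^{su}_A$ dominated ($E^{su}$ being the more strongly expanded), and correspondingly, along each full orbit of $f$, there is an invariant dominated splitting $E^u_f=E^{wu}_f\oplus E^{su}_f$ into one-dimensional bundles. $\lambda^{wu}_f(x)$ and $\lambda^{su}_f(x)$ denote the Lyapunov exponents $\lim_{n\to+\infty}\frac1n\log\|Df^n(x)v\|$ for nonzero $v$ in $E^{wu}_f(x)$, respectively $E^{su}_f(x)$, where these limits exist. Since $m$ is ergodic for $A$, $\tilde m$ is ergodic for $f$, so these exponents are $\tilde m$-a.e. constant, and the constants are denoted $\lambda^{wu}_f(\tilde m)$ and $\lambda^{su}_f(\tilde m)$. Absolute continuity of $h$: the measure $h_*(m)$ is absolutely continuous with respect to $m$. *)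

(* Defs.v *)
From HB Require Import structures.
From mathcomp Require Import all_boot all_order all_algebra.
From mathcomp Require Import generic_quotient.
From mathcomp Require Import all_classical all_reals all_analysis.
Import Order.TTheory GRing.Theory Num.Theory.
Import numFieldNormedType.Exports.

Set Implicit Arguments.
Unset Strict Implicit.
Unset Printing Implicit Defensive.

Local Open Scope classical_set_scope.
Local Open Scope ring_scope.
Local Open Scope quotient_scope.

(** Conventions.  Vectors of R^3 are row vectors, so matrices act on the right.
    The tangent bundle of T^3 is trivialized as T^3 x R^3; maps of the torus are
    differentiated through lifts to R^3.  The library norm on row vectors is the
    sup norm: it is equivalent to the Euclidean one, and is only used in notions
    (uniform rates up to a constant, exponents, Lipschitz maps) that do not
    depend on that choice. *)

Section Smooth.
Variables (R : realType) (V W : normedModType R).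

Fixpoint Ck_on (k : nat) (U : set V) (g : V -> W) : Prop :=
  match k with
  | 0 => forall x, U x -> {for x, continuous g}
  | k'.+1 => (forall x, U x -> differentiable g x) /\
             (forall v, Ck_on k' U (fun x => 'D_v g x))
  end.

End Smooth.

Section Torus.
Variable R : realType.
Local Notation E3 := 'rV[R]_3.

Definition Z3_congr (x y : E3) : bool :=
  [forall i, x ord0 i - y ord0 i \is a Num.int].

Lemma Z3_congr_equiv : equiv_class_of Z3_congr.
Proof.
split=> [x|x y|y x z].
- by apply/forallP => i; rewrite subrr rpred0.
- by apply/forallP/forallP => xy i; rewrite -opprB rpredN.
- move=> /forallP xy /forallP yz; apply/forallP => i.
  by rewrite -(subrKA (y ord0 i)) rpredD.
Qed.

Canonical Z3_congr_equivrel := EquivRelPack Z3_congr_equiv.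

Definition torus := quotient_topology {eq_quot Z3_congr}.

Definition tproj (x : E3) : torus := \pi_torus x.

Lemma tproj_eq (x y : E3) : tproj x = tproj y <-> Z3_congr x y.
Proof.
have piE z : tproj z = (\pi_({eq_quot Z3_congr}) z : torus).
  by rewrite /tproj !unlock.
rewrite !piE; have H := @eqmodP _ Z3_congr_equivrel x y.
by split=> h; exact/H.
Qed.

Definition tdist (p q : torus) : R :=
  inf [set r | exists x y, [/\ tproj x = p, tproj y = q & r = `|x - y|]].

Definition vec3 (t : R * R * R) : E3 :=
  \row_i [:: t.1.1; t.1.2; t.2]`_i.

Definition tpar (t : R * R * R) : torus := tproj (vec3 t).

(** A set is measurable when its preimage in R^3 is Borel; since the projection
    is a local homeomorphism this is the Borel sigma-algebra of the torus. *)
Definition torus_measurable : set (set torus) :=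
  image_set_system setT tpar measurable.

Let torus_sigma : sigma_algebra setT torus_measurable.
Proof. exact/sigma_algebra_image/sigma_algebra_measurable. Qed.

Let torus_measurable0 : torus_measurable set0.
Proof. by case: torus_sigma. Qed.

Let torus_measurableC A : torus_measurable A -> torus_measurable (~` A).
Proof. by case: torus_sigma => _ + _ => /[apply]; rewrite setTD. Qed.

Let torus_measurableU (F : (set torus)^nat) :
  (forall i, torus_measurable (F i)) -> torus_measurable (\bigcup_i F i).
Proof. by case: torus_sigma => _ _; apply. Qed.

HB.instance Definition _ := Pointed.on torus.
HB.instance Definition _ := @isMeasurable.Build default_measure_display torus
  torus_measurable torus_measurable0 torus_measurableC torus_measurableU.

Definition unit_cube : set (R * R * R) :=
  (`[0, 1[ `*` `[0, 1[) `*` `[0, 1[.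

Lemma measurable_unit_cube : measurable unit_cube.
Proof. by do 2?[apply: measurableX]. Qed.

Definition lebesgue2 := (@lebesgue_measure R \x @lebesgue_measure R)%E.
Definition lebesgue3 := (lebesgue2 \x @lebesgue_measure R)%E.

Definition haar : set torus -> \bar R :=
  pushforward (mrestr lebesgue3 measurable_unit_cube) tpar.

Lemma haar_setT : haar setT = 1%E.
Proof.
rewrite /haar /pushforward preimage_setT /mrestr setTI /lebesgue3 /lebesgue2.
rewrite product_measure1E//=; last exact: measurableX.
by rewrite product_measure1E//= lebesgue_measure_itv/= lte_fin ltr01 sube0 !mule1.
Qed.

Definition homeo (h : torus -> torus) : Prop :=
  continuous h /\
  exists g : torus -> torus, [/\ continuous g, cancel h g & cancel g h].

Definition is_lift (F : E3 -> E3) (f : torus -> torus) : Prop :=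
  continuous F /\ forall x, tproj (F x) = f (tproj x).

(** Smoothness in the charts given by local inverses of the projection. *)
Definition torus_Ck (k : nat) (f : torus -> torus) : Prop :=
  forall x : E3, exists (U : set E3) (G : E3 -> E3),
    [/\ open U, U x, Ck_on k U G & forall y, U y -> tproj (G y) = f (tproj y)].

Definition torus_smooth (f : torus -> torus) : Prop :=
  forall k, torus_Ck k f.

Definition torus_local_diffeo (f : torus -> torus) : Prop :=
  forall x : E3, exists (U : set E3) (G G' : E3 -> E3),
    [/\ open U /\ U x,
        Ck_on 1 U G,
        forall y, U y -> tproj (G y) = f (tproj y),
        open (G @` U) /\ Ck_on 1 (G @` U) G' &
        forall y, U y -> G' (G y) = y].

Definition torus_lipschitz (h : torus -> torus) : Prop :=
  exists L : R, forall p q, tdist (h p) (h q) <= L * tdist p q.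

Definition linear_lift (A : 'M[int]_3) (x : E3) : E3 := x *m map_mx intr A.

Definition linear_endo (A : 'M[int]_3) (p : torus) : torus :=
  tproj (linear_lift A (repr p)).

(** The deck transformations are the integer translations, so this says that
    [A] is the endomorphism of Z^3 = pi_1(T^3) induced by the map lifted by [F]. *)
Definition linearization (F : E3 -> E3) (A : 'M[int]_3) : Prop :=
  forall (x : E3) (n : 'rV[int]_3),
    F (x + map_mx intr n) = F x + map_mx intr (n *m A).

Definition full_orbit (f : torus -> torus) (xs : int -> torus) : Prop :=
  forall i, f (xs i) = xs (i + 1).

(** Derivative at [p] of the [n]-th iterate of the torus map lifted by [F]; it
    does not depend on the representative of [p], two of which differ by a deck
    transformation. *)
Definition Dn (F : E3 -> E3) (n : nat) (p : torus) : E3 -> E3 :=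
  'd (iter n F) (repr p).

(** The fibre over [xs i] may depend on the whole full orbit [xs]. *)
Definition orbit_bundle := (int -> torus) -> int -> {vspace E3}.

Definition invariant_bundle (f : torus -> torus) (F : E3 -> E3)
    (E : orbit_bundle) : Prop :=
  forall xs, full_orbit f xs -> forall i,
    (linfun (Dn F 1 (xs i)) @: E xs i)%VS = E xs (i + 1).

Definition hyperbolic_splitting (f : torus -> torus) (F : E3 -> E3)
    (Es Eu : orbit_bundle) : Prop :=
  [/\ invariant_bundle f F Es, invariant_bundle f F Eu,
      forall xs, full_orbit f xs -> forall i,
        (Es xs i + Eu xs i)%VS = fullv /\ (Es xs i :&: Eu xs i)%VS = 0%VS &
      exists C rho : R, [/\ 0 < C, 0 < rho < 1 &
        forall xs, full_orbit f xs -> forall i n,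
          (forall v, v \in Es xs i -> `|Dn F n (xs i) v| <= C * rho ^+ n * `|v|) /\
          (forall v, v \in Eu xs i -> `|v| <= C * rho ^+ n * `|Dn F n (xs i) v|)]].

Definition anosov (f : torus -> torus) (F : E3 -> E3) : Prop :=
  torus_local_diffeo f /\ exists Es Eu, hyperbolic_splitting f F Es Eu.

Definition wu_su_splitting (f : torus -> torus) (F : E3 -> E3)
    (Es Ewu Esu : orbit_bundle) : Prop :=
  [/\ hyperbolic_splitting f F Es (fun xs i => Ewu xs i + Esu xs i)%VS,
      invariant_bundle f F Ewu, invariant_bundle f F Esu,
      forall xs, full_orbit f xs -> forall i,
        [/\ \dim (Es xs i) = 1%N, \dim (Ewu xs i) = 1%N, \dim (Esu xs i) = 1%N &
            (Ewu xs i :&: Esu xs i)%VS = 0%VS] &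
      exists C rho : R, [/\ 0 < C, 0 < rho < 1 &
        forall xs, full_orbit f xs -> forall i n v w,
          v \in Ewu xs i -> w \in Esu xs i ->
          `|Dn F n (xs i) v| * `|w| <=
            C * rho ^+ n * (`|Dn F n (xs i) w| * `|v|)]].

Definition special (f : torus -> torus) (Ewu Esu : orbit_bundle)
    (Eu : torus -> {vspace E3}) : Prop :=
  forall xs, full_orbit f xs -> forall i, (Ewu xs i + Esu xs i)%VS = Eu (xs i).

(** The exponent along the fibre of [E] over [p] exists and equals [l].  A fibre
    over [p] is determined by a full orbit through [p]; the clause on existence
    only rules out vacuity. *)
Definition exponent (f : torus -> torus) (F : E3 -> E3) (E : orbit_bundle)
    (p : torus) (l : R) : Prop :=
  (exists xs, full_orbit f xs /\ xs 0 = p) /\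
  forall xs, full_orbit f xs -> xs 0 = p -> forall v, v \in E xs 0 -> v != 0 ->
    (n%:R^-1 * ln `|Dn F n p v|) @[n --> \oo] --> l.

Definition Zset (f : torus -> torus) (F : E3 -> E3) (Ewu Esu : orbit_bundle)
    (l : R) : set torus :=
  [set p | exists a b : R,
    [/\ exponent f F Ewu p a, exponent f F Esu p b & a + b = l]].

(** Leaf through [p] of the foliation tangent to [Eu]: the points joined to [p]
    by a C^1 curve tangent to [Eu]; such a curve stays in one leaf, because its
    lifts are uniformly contracted by the inverse branches of the dynamics. *)
Definition unstable_leaf (Eu : torus -> {vspace E3}) (p : torus) : set torus :=
  [set q | exists c : R -> E3,
    [/\ Ck_on 1 setT c, forall t, derive1 c t \in Eu (tproj (c t)),
        tproj (c 0) = p & tproj (c 1) = q]].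

Definition dotp (u v : E3) : R := \sum_i u ord0 i * v ord0 i.

(** Riemannian area density of a parametrized surface, for the flat metric. *)
Definition area_density (s : R * R -> E3) (t : R * R) : R :=
  let a := 'D_(1, 0) s t in let b := 'D_(0, 1) s t in
  Num.sqrt (dotp a a * dotp b b - dotp a b ^+ 2).

Definition leaf_chart (W : set torus) (U : set (R * R)) (s : R * R -> E3) : Prop :=
  [/\ open U, Ck_on 1 U s, forall t, U t -> area_density s t != 0,
      {in U &, injective (fun t => tproj (s t))} &
      forall t, U t -> W (tproj (s t))].

(** Lebesgue measure of the leaf [W] induced by its Riemannian metric.  The
    domain of a chart is any open subset of R^2, possibly disconnected, so that
    a single chart can cover a leaf up to a null set. *)
Definition leaf_measure (W S : set torus) : \bar R :=
  ereal_sup [set a | exists U s, leaf_chart W U s /\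
    a = (\int[lebesgue2]_(t in U `&` [set t | S (tproj (s t))])
           (area_density s t)%:E)%E].

End Torus.

(* Main.v *)
Require Import Defs.
From HB Require Import structures.
From mathcomp Require Import all_boot all_order all_algebra.
From mathcomp Require Import generic_quotient.
From mathcomp Require Import all_classical all_reals all_analysis.
From mathcomp Require Import ring lra zify.
Import Order.TTheory GRing.Theory Num.Theory.
Import numFieldNormedType.Exports.

Set Implicit Arguments.
Unset Strict Implicit.
Unset Printing Implicit Defensive.

Local Open Scope classical_set_scope.
Local Open Scope ring_scope.

(** The example is the skew product f(x, z) = (M x, 2 z - phi(x)) over the
    hyperbolic automorphism M = [[2,1],[1,0]] of T^2, with
    phi(x) = (1 - cos (2 pi x_0)) / 4.  Its linearization is A = M x 2, whose
    eigenvalues are -1/mu, 2 and mu, where mu = 1 + sqrt 2 > 2.  The conjugacy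
    is the shear h(x, z) = (x, z + psi(x)), where psi is the Weierstrass-type
    series psi = sum_k 2^(-k-1) phi o M^k, which solves
    psi o M = 2 psi - phi.  The shear preserves Haar measure by Fubini.  Along
    the expanding direction w of M, psi(t w) >= 2^(-n) / 4 at t = mu^(-n) / 2;
    as mu > 2 this rules out any Lipschitz bound.  The line spanned by e_3 and
    the plane spanned by e_3 and (w, 0) are invariant under Df; the strong
    unstable and stable lines are graphs over the eigenlines of M, with slopes
    given by geometric series along backward and forward orbits.  As Df is
    triangular, the exponents are ln 2 and ln mu at every point, so Z = T^3. *)

(** * Power series with bounded coefficients *)

Section GeometricSums.
Variable R : realType.
Implicit Types (q B : R) (g : nat -> R).

(** With [g] sampled along an orbit, this one form covers the conjugating function and the slopes of
    the invariant lines. *)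
Definition geom_sum q g : R := limn (series (fun k => q ^+ k * g k)).

Lemma geom_sum_cvg q g B : `|q| < 1 -> (forall k, `|g k| <= B) ->
  cvgn (series (fun k => q ^+ k * g k)).
Proof.
move=> q1 gB; apply: normed_cvg.
apply: (@series_le_cvg _ _ (geometric B `|q|)) => [n|n|n|].
- exact: normr_ge0.
- by rewrite /geometric /= mulr_ge0// (le_trans _ (gB 0%N)).
- by rewrite /geometric /= normrM normrX mulrC ler_wpM2r.
- by apply: is_cvg_geometric_series; rewrite normr_id.
Qed.

(** Peeling off the first term turns a sum along an orbit into a functional equation between a point
    and its image. *)
Lemma geom_sum_rec q g B : `|q| < 1 -> (forall k, `|g k| <= B) ->
  geom_sum q g = g 0%N + q * geom_sum q (fun k => g k.+1).
Proof.
move=> q1 gB; apply/cvg_lim => //.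
rewrite -(cvg_shiftS (series _)) /=.
rewrite [X in X @ _ --> _](_ : _ =
    (fun n => g 0%N + q * series (fun k => q ^+ k * g k.+1) n)); last first.
  apply/funext => n; rewrite /series /= big_nat_recl//= expr0 mul1r mulr_sumr.
  by congr (_ + _); apply: eq_bigr => i _; rewrite exprS mulrA.
apply: cvgD; first exact: cvg_cst.
by apply: cvgMl_tmp; apply: (geom_sum_cvg (B := B)).
Qed.

Lemma geom_sum_le q g B : `|q| < 1 -> (forall k, `|g k| <= B) ->
  `|geom_sum q g| <= B / (1 - `|q|).
Proof.
move=> q1 gB.
have q1' : `| `|q| | < 1 by rewrite normr_id.
have cn : cvgn [normed series (fun k => q ^+ k * g k)].
  apply: (@series_le_cvg _ _ (geometric B `|q|)) => [n|n|n|].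
  - exact: normr_ge0.
  - by rewrite /geometric /= mulr_ge0// (le_trans _ (gB 0%N)).
  - by rewrite /geometric /= normrM normrX mulrC ler_wpM2r.
  - exact: is_cvg_geometric_series.
rewrite (le_trans (lim_series_norm cn))//.
rewrite -(cvg_lim _ (cvg_geometric_series (a := B) q1'))//.
apply: lim_series_le => //; first exact: is_cvg_geometric_series.
by move=> n; rewrite /geometric /= normrM normrX mulrC ler_wpM2r.
Qed.

Lemma geom_sum_ge0 q g B : 0 <= q < 1 -> (forall k, 0 <= g k <= B) ->
  0 <= geom_sum q g.
Proof.
move=> /andP[q0 q1] gB; apply: limr_ge.
  apply: (@geom_sum_cvg _ _ B); first by rewrite ger0_norm.
  by move=> k; have /andP[? ?] := gB k; rewrite ger0_norm.
apply: nearW => n; apply: sumr_ge0 => k _.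
by have /andP[? ?] := gB k; rewrite mulr_ge0// exprn_ge0.
Qed.

Lemma geom_sum_split q g B n : `|q| < 1 -> (forall k, `|g k| <= B) ->
  geom_sum q g = \sum_(k < n) q ^+ k * g k +
                 q ^+ n * geom_sum q (fun k => g (n + k)%N).
Proof.
move=> q1; elim: n g => [|n ih] g gB.
  by rewrite big_ord0 expr0 mul1r add0r.
rewrite (geom_sum_rec q1 gB) (ih (fun k => g k.+1)); last by move=> k.
rewrite big_ord_recl/= expr0 mul1r mulrDr mulrA -exprS addrA mulr_sumr.
congr (_ + _ + _).
by apply: eq_bigr => i _; rewrite /= exprS mulrA.
Qed.

Lemma geom_sum_continuous (T : topologicalType) (g : nat -> T -> R) q B :
  `|q| < 1 -> (forall k x, `|g k x| <= B) -> (forall k, continuous (g k)) ->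
  continuous (fun x => geom_sum q (g^~ x)).
Proof.
move=> q1 gB gc x; apply/cvgrPdist_lt => e e0.
pose C := B / (1 - `|q|).
have C0 : 0 <= C.
  by rewrite divr_ge0 ?subr_ge0 ?(ltW q1)// (le_trans (normr_ge0 _) (gB 0%N x)).
(* This [n] depends on [e] alone, so the tails at [x] and at [y] are both smaller than [e / 3]; only
   the finite sum needs [y] close to [x]. *)
have [n nP] : exists n, `|q| ^+ n * C < e / 3.
  have : (fun n => `|q| ^+ n * C) @ \oo --> (0 : R).
    rewrite -[0](mul0r C); apply: cvgMr_tmp.
    by apply: cvg_expr; rewrite normr_id.
  move=> /cvgrPdist_lt /(_ (e / 3)) []; first by rewrite divr_gt0.
  move=> n _ /(_ n (leqnn n)) /=.
  rewrite sub0r normrN ger0_norm; first by exists n.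
  by rewrite mulr_ge0// exprn_ge0.
pose S y := \sum_(k < n) q ^+ k * g k y.
have Sc : {for x, continuous S}.
  apply: cvg_big => [|i _]; first exact: add_continuous.
  by apply: cvgMl_tmp; exact: gc.
have tail y : `|q ^+ n * geom_sum q (fun k => g (n + k)%N y)| < e / 3.
  rewrite normrM normrX (le_lt_trans _ nP)// ler_wpM2l ?exprn_ge0//.
  by apply: geom_sum_le.
near=> y.
rewrite !(geom_sum_split n q1 (fun k => gB k _)) -!/(S _).
rewrite opprD addrACA (le_lt_trans (ler_normD _ _))//.
rewrite (le_lt_trans (lerD (lexx _) (ler_normB _ _)))//.
have -> : e = e / 3 + (e / 3 + e / 3) by lra.
rewrite ltrD// ?ltrD//.
near: y; move/cvgrPdist_lt : Sc => /(_ (e / 3)); apply.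
by rewrite divr_gt0.
Unshelve. all: by end_near. Qed.

End GeometricSums.

(** * Coordinates and the sup norm on R^3 *)

Notation i0 := (@Ordinal 3 0 isT).
Notation i1 := (@Ordinal 3 1 isT).
Notation i2 := (@Ordinal 3 2 isT).

Section Vectors.
Variable R : realType.
Local Notation E3 := 'rV[R]_3.

Lemma row3P (x y : E3) : x ord0 i0 = y ord0 i0 -> x ord0 i1 = y ord0 i1 ->
  x ord0 i2 = y ord0 i2 -> x = y.
Proof.
move=> e0 e1 e2; apply/rowP => -[[|[|[|//]]] p].
- by rewrite (_ : Ordinal p = i0)//; apply: val_inj.
- by rewrite (_ : Ordinal p = i1)//; apply: val_inj.
- by rewrite (_ : Ordinal p = i2)//; apply: val_inj.
Qed.

Lemma vec3_0 (t : R * R * R) : vec3 t ord0 i0 = t.1.1.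
Proof. by rewrite mxE. Qed.
Lemma vec3_1 (t : R * R * R) : vec3 t ord0 i1 = t.1.2.
Proof. by rewrite mxE. Qed.
Lemma vec3_2 (t : R * R * R) : vec3 t ord0 i2 = t.2.
Proof. by rewrite mxE. Qed.
Definition vec3E := (vec3_0, vec3_1, vec3_2).

Lemma ler_coord (x : E3) j : `|x ord0 j| <= `|x|.
Proof.
rewrite [leRHS]/Num.Def.normr/= mx_normrE.
exact: (le_bigmax _ (fun ij : 'I_1 * 'I_3 => `|x ij.1 ij.2|) (ord0, j)).
Qed.

Lemma ler_norm3 (x : E3) B : `|x ord0 i0| <= B -> `|x ord0 i1| <= B ->
  `|x ord0 i2| <= B -> `|x| <= B.
Proof.
move=> h0 h1 h2; rewrite [leLHS]/Num.Def.normr/= mx_normrE.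
apply: bigmax_le => [|[i j] _]; first exact: le_trans h0.
rewrite (ord1 i) /=; case: j => -[|[|[|//]]] p.
- by rewrite (_ : Ordinal p = i0)//; apply: val_inj.
- by rewrite (_ : Ordinal p = i1)//; apply: val_inj.
- by rewrite (_ : Ordinal p = i2)//; apply: val_inj.
Qed.

End Vectors.

(** * Differentiability of trigonometric maps *)

Section TrigonometricMaps.
Variable R : realType.
Local Notation E3 := 'rV[R]_3.
Implicit Types (B : 'M[R]_3) (x v w c : E3) (j : 'I_3) (a b om : R).

Lemma is_diff_coord j x :
  is_diff x (fun y : E3 => y ord0 j) (fun v : E3 => v ord0 j).
Proof.
have @f : {linear E3 -> R}.
  by exists (fun N : E3 => N ord0 j); do 2![eexists]; do ?[constructor];
     rewrite ?mxE// => ? *; rewrite ?mxE//; move=> ?; rewrite !mxE.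
apply: DiffDef; first exact: differentiable_coord.
by rewrite (diff_lin (f := f)) //; apply: coord_continuous.
Qed.

Lemma is_diff_mulmx B x : is_diff x (fun y : E3 => y *m B) (fun v : E3 => v *m B).
Proof.
have cB : continuous (fun y : E3 => y *m B).
  rewrite (_ : mulmx^~ B = fun y => \sum_i y ord0 i *: row i B); last first.
    by apply/funext => y; rewrite mulmx_sum_row.
  apply: continuous_big => [|i _ y]; first exact: add_continuous.
  apply: (@continuous_comp _ _ _ (fun y : E3 => y ord0 i) ( *:%R^~ (row i B))).
    exact: coord_continuous.
  exact: scalel_continuous.
apply: DiffDef; first exact: (linear_differentiable (f := mulmxr B)).
by rewrite (diff_lin (f := mulmxr B)).
Qed.

Definition trig om a b (t : R) : R := a * cos (om * t) + b * sin (om * t).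

Lemma is_derive_trig om a b (t : R) :
  is_derive t 1 (trig om a b) (trig om (b * om) (- a * om) t).
Proof.
have lin : is_derive t 1 ( *%R om) om.
  rewrite (_ : *%R om = om *: (id : R -> R))//.
  by apply: is_derive_eq; rewrite /GRing.scale /= mulr1.
have hc : is_derive t 1 (cos \o ( *%R om)) (- sin (om * t) * om).
  exact: is_derive1_comp.
have hs : is_derive t 1 (sin \o ( *%R om)) (cos (om * t) * om).
  exact: is_derive1_comp.
have -> : trig om a b = a *: (cos \o ( *%R om)) + b *: (sin \o ( *%R om)).
  by [].
by apply: is_derive_eq; rewrite /trig /GRing.scale /=; ring.
Qed.

(** Affine map plus one harmonic of one coordinate: a class that contains the lift and its inverse
    and is stable under directional derivatives. *)
Definition trig_map j om B c a b w x : E3 := x *m B + c + trig om a b (x ord0 j) *: w.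

Lemma is_diff_trig_map j om B c a b w x :
  is_diff x (trig_map j om B c a b w)
    (fun v => v *m B + (v ord0 j * trig om (b * om) (- a * om) (x ord0 j)) *: w).
Proof.
have dt : is_diff (x ord0 j : R) (trig om a b : R -> R)
    ( *:%R^~ (trig om (b * om) (- a * om) (x ord0 j))).
  have dd := is_derive_trig om a b (x ord0 j).
  have d1 : derivable (trig om a b) (x ord0 j) 1 by exact: ex_derive.
  apply: DiffDef; first exact/derivable1_diffP.
  by rewrite deriv1E// derive1E derive_val.
have dj := is_diff_coord j x.
have dB := is_diff_mulmx B x.
have dc := is_diff_comp dj dt.
have ds := is_diff_scalel (trig om a b (x ord0 j)) w.
have dsc := is_diff_comp dc ds.
have := is_diffD (is_diffD dB (is_diff_cst c x)) dsc.
rewrite /trig_map /=; congr is_diff_def.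
by apply/funext => v /=; rewrite addr0.
Qed.

(** Deriving along [v] turns the linear part into a constant and leaves a map of the same class;
    hence the induction over all coefficients. *)
Lemma Ck_trig_map k U j om B c a b w : Ck_on k U (trig_map j om B c a b w).
Proof.
elim: k B c a b w => [|k ih] B c a b w /=.
  by move=> x _; apply: differentiable_continuous; have [] := is_diff_trig_map j om B c a b w x.
split=> [x _|v]; first by have [] := is_diff_trig_map j om B c a b w x.
rewrite (_ : (fun x => _) =
    trig_map j om 0 (v *m B) (b * om) (- a * om) (v ord0 j *: w)); first exact: ih.
apply/funext => x; have [d1 d2] := is_diff_trig_map j om B c a b w x.
by rewrite deriveE// d2 /trig_map mulmx0 add0r scalerA mulrC.
Qed.

End TrigonometricMaps.

(** * Descent of maps from R^3 to the torus *)

Section TorusMaps.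
Variable R : realType.
Local Notation E3 := 'rV[R]_3.
Local Notation zvec n := (map_mx (intr : int -> R) n).

(** Descends [F] through a chosen representative; the choice is immaterial as soon as [F] has a
    linearization. *)
Definition tmap (F : E3 -> E3) (p : torus R) : torus R := tproj (F (repr p)).

Lemma tprojK (p : torus R) : tproj (repr p) = p.
Proof. exact: reprK. Qed.

Lemma tproj_zvec (x : E3) (n : 'rV[int]_3) : tproj (x + zvec n) = tproj x.
Proof. by apply/tproj_eq/forallP => i; rewrite mxE addrAC subrr add0r mxE intr_int. Qed.

Lemma tproj_inj (x y : E3) : tproj x = tproj y -> exists n, x = y + zvec n.
Proof.
move=> /tproj_eq /forallP xy.
have xy' i : {m | x ord0 i - y ord0 i = m%:~R} by apply/cid/intrP/xy.
exists (\row_i sval (xy' i)); apply/rowP => i; rewrite !mxE.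
by rewrite -(svalP (xy' i)) addrC subrK.
Qed.

Lemma repr_tproj (x : E3) : exists n, repr (tproj x) = x + zvec n.
Proof. by apply: tproj_inj; rewrite tprojK. Qed.

Lemma tmapE (F : E3 -> E3) (A : 'M[int]_3) : linearization F A ->
  forall x, tproj (F x) = tmap F (tproj x).
Proof.
by move=> FA x; rewrite /tmap; have [n ->] := repr_tproj x; rewrite FA tproj_zvec.
Qed.

Lemma tmap_continuous (F : E3 -> E3) (A : 'M[int]_3) : linearization F A ->
  continuous F -> continuous (tmap F).
Proof.
move=> FA Fc; apply/quotient_continuous.
rewrite (_ : _ \o _ = tproj (R:=R) \o F).
  move=> x; apply: continuous_comp; first exact: Fc.
  exact: pi_continuous.
by apply/funext => x /=; rewrite (tmapE FA).
Qed.

End TorusMaps.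

(** * The skew product, its inverse on R^3 and its derivative *)

Section SkewProduct.
Variable R : realType.
Local Notation E3 := 'rV[R]_3.
Local Notation om := (pi *+ 2 : R).

Lemma cos_period (t : R) (z : int) : cos (om * (t + z%:~R)) = cos (om * t).
Proof.
have cosn u n : cos (om * (u + n%:R)) = cos (om * u) :> R.
  by rewrite mulrDr mulr_natr (periodicn (@cosD2pi R)).
case: z => n; first exact: cosn.
(* For negative [z], the natural case is applied at [t + z], where adding [n.+1] returns to [t]. *)
by rewrite NegzE mulrNz -[LHS](cosn _ n.+1) subrK.
Qed.

Lemma sin_period (t : R) (z : int) : sin (om * (t + z%:~R)) = sin (om * t).
Proof.
have sinn u n : sin (om * (u + n%:R)) = sin (om * u) :> R.
  by rewrite mulrDr mulr_natr (periodicn (@sinD2pi R)).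
case: z => n; first exact: sinn.
by rewrite NegzE mulrNz -[LHS](sinn _ n.+1) subrK.
Qed.

Definition skew_mx : 'M[int]_3 := \matrix_(i, j)
  nth 0 (nth [::] [:: [:: 2; 1; 0]; [:: 1; 0; 0]; [:: 0; 0; 2]] i) j.

Definition wave (t : R) : R := 1 - cos (om * t).

(** [c = - 1 / 4] gives the nonlinear map of the theorem, [c = 0] the linear one. *)
Definition skew_map (c : R) (x : E3) : E3 :=
  vec3 ((2 * x ord0 i0 + x ord0 i1, x ord0 i0), 2 * x ord0 i2 + c * wave (x ord0 i0)).

(** An inverse on R^3 only: the factor 2 makes the torus map two-to-one. It supplies the local
    inverses and the backward orbits. *)
Definition skew_inv (c : R) (y : E3) : E3 :=
  vec3 ((y ord0 i1, y ord0 i0 - 2 * y ord0 i1),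
    (y ord0 i2 - c * wave (y ord0 i1)) / 2).

Lemma skewK c : cancel (skew_map c) (skew_inv c).
Proof. by move=> x; apply: row3P; rewrite !vec3E /= ?vec3E /=; field. Qed.

Lemma skew_invK c : cancel (skew_inv c) (skew_map c).
Proof. by move=> x; apply: row3P; rewrite !vec3E /= ?vec3E /=; field. Qed.

Definition e3 : E3 := vec3 ((0, 0), 1).

Lemma mulmx3 (B : 'M[R]_3) (x : E3) j : (x *m B) ord0 j =
  x ord0 i0 * B i0 j + x ord0 i1 * B i1 j + x ord0 i2 * B i2 j.
Proof.
rewrite mxE !big_ord_recl big_ord0 addr0 addrA.
by congr (_ * _ + _ * _ + _ * _); congr (_ _ _); apply: val_inj.
Qed.

Lemma skew_trig c : skew_map c =
  trig_map i0 om (map_mx intr skew_mx) (c *: e3) (- c) 0 e3.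
Proof.
apply/funext => x; rewrite /trig_map /trig /skew_map /wave.
by apply: row3P; rewrite !(vec3E, mulmx3, mxE) /=; ring.
Qed.

Lemma skew_inv_trig c : skew_inv c =
  trig_map i1 om
    (\matrix_(i, j) nth 0 (nth [::] [:: [:: 0; 1; 0]; [:: 1; -2; 0]; [:: 0; 0; 2^-1]] i) j)
    (- (c / 2) *: e3) (c / 2) 0 e3.
Proof.
apply/funext => x; rewrite /trig_map /trig /skew_inv /wave.
by apply: row3P; rewrite !(vec3E, mulmx3, mxE) /=; field.
Qed.

Lemma skew_Ck c k U : Ck_on k U (skew_map c).
Proof. by rewrite skew_trig; apply: Ck_trig_map. Qed.

Lemma skew_inv_Ck c k U : Ck_on k U (skew_inv c).
Proof. by rewrite skew_inv_trig; apply: Ck_trig_map. Qed.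

Lemma skew_continuous c : continuous (skew_map c).
Proof. by move=> x; have := skew_Ck c 0 setT; apply. Qed.

Lemma skew_linearization c : linearization (skew_map c) skew_mx.
Proof.
move=> x n; rewrite map_mxM /skew_map /wave.
apply: row3P; rewrite !(vec3E, mulmx3, mxE) /= ?cos_period; ring.
Qed.

Lemma skew_linear_lift : linear_lift skew_mx = skew_map 0.
Proof.
apply/funext => x; rewrite skew_trig /trig_map /trig scale0r addr0.
by rewrite oppr0 !mul0r addr0 scale0r addr0.
Qed.

Definition dwave (t : R) : R := om * sin (om * t).

Lemma is_diff_skew c (x : E3) : is_diff x (skew_map c) (fun v =>
  vec3 ((2 * v ord0 i0 + v ord0 i1, v ord0 i0),
        2 * v ord0 i2 + c * dwave (x ord0 i0) * v ord0 i0)).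
Proof.
rewrite skew_trig.
have := is_diff_trig_map i0 om (map_mx intr skew_mx) (c *: e3) (- c) 0 e3 x.
congr is_diff_def; apply/funext => v.
by apply: row3P; rewrite !(vec3E, mulmx3, mxE) /= /trig /dwave; ring.
Qed.

Lemma differentiable_iter_skew c n (x : E3) : differentiable (iter n (skew_map c)) x.
Proof.
elim: n => [|n ih]; first by case: (is_diff_id x).
apply: (@differentiable_comp _ _ _ _ (iter n (skew_map c)) (skew_map c)) => //.
by case: (is_diff_skew c (iter n (skew_map c) x)).
Qed.

Lemma diff_iter_skewS c n (x v : E3) :
  'd (iter n.+1 (skew_map c)) x v =
  'd (skew_map c) (iter n (skew_map c) x) ('d (iter n (skew_map c)) x v).
Proof.
have d1 := differentiable_iter_skew c n x.
have d2 : differentiable (skew_map c) (iter n (skew_map c) x).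
  by case: (is_diff_skew c (iter n (skew_map c) x)).
exact: (congr1 (fun h => h v) (diff_comp d1 d2)).
Qed.

End SkewProduct.

(** * The hyperbolic automorphism of the base and the slopes over it *)

Section BaseMap.
Variable R : realType.
Local Notation E3 := 'rV[R]_3.
Local Notation om := (pi *+ 2 : R).
Implicit Types u v : R * R.

Definition base (x : E3) : R * R := (x ord0 i0, x ord0 i1).
Definition bmap u : R * R := (2 * u.1 + u.2, u.1).
Definition binv u : R * R := (u.2, u.1 - 2 * u.2).

Lemma bmapK : cancel bmap binv.
Proof. by case=> a b; rewrite /bmap /binv /=; congr (_, _); ring. Qed.

Lemma base_skew c x : base (skew_map c x) = bmap (base x).
Proof. by rewrite /base /skew_map !vec3E. Qed.

Definition zcongr u v := exists m n : int, u = (v.1 + m%:~R, v.2 + n%:~R).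

Lemma zcongr_bmap k u v : zcongr u v -> zcongr (iter k bmap u) (iter k bmap v).
Proof.
move=> uv; elim: k => //= k [m [n ->]].
exists (2 * m + n), m; rewrite /bmap /= rmorphD rmorphM /=.
by congr (_, _); ring.
Qed.

Lemma zcongr_binv k u v : zcongr u v -> zcongr (iter k binv u) (iter k binv v).
Proof.
move=> uv; elim: k => //= k [m [n ->]].
exists n, (m - 2 * n); rewrite /binv /= rmorphB rmorphM /=.
by congr (_, _); ring.
Qed.

Lemma zcongr_repr (x : E3) : zcongr (base (repr (tproj x))) (base x).
Proof.
have [n ->] := repr_tproj x.
by exists (n ord0 i0), (n ord0 i1); rewrite /base !mxE.
Qed.

Lemma wave_zcongr u v : zcongr u v -> wave u.1 = wave v.1.
Proof. by move=> [m [n ->]]; rewrite /wave cos_period. Qed.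

Lemma dwave_zcongr u v : zcongr u v -> dwave u.1 = dwave v.1.
Proof. by move=> [m [n ->]]; rewrite /dwave sin_period. Qed.

Lemma ler_dwave t : `|dwave t| <= om.
Proof.
have om0 : 0 <= om by rewrite mulrn_wge0// pi_ge0.
rewrite /dwave normrM (ger0_norm om0) ler_piMr// ler_norml.
by rewrite sin_geN1 sin_le1.
Qed.

Definition mu : R := 1 + Num.sqrt 2.
(** The contracting eigenvalue -1/mu of M, written through the trace 2. *)
Definition sg : R := 2 - mu.

Lemma mu_sqr : mu ^+ 2 = 2 * mu + 1.
Proof.
have s2 : Num.sqrt 2 ^+ 2 = 2 :> R by rewrite sqr_sqrtr.
by rewrite /mu; ring: s2.
Qed.

(** The gap between the two expansion rates: it gives the domination and defeats the Lipschitz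
    bound. *)
Lemma mu_gt2 : 2 < mu.
Proof.
rewrite /mu -ltrBlDl (_ : 2 - 1 = Num.sqrt 1); last by rewrite sqrtr1; ring.
by rewrite ltr_sqrt; lra.
Qed.

Lemma mu_lt3 : mu < 3.
Proof. by have := mu_sqr; have := mu_gt2; nra. Qed.

Lemma mu_neq0 : mu != 0.
Proof. by have := mu_gt2; lra. Qed.

Lemma norm_sg : `|sg| < 2^-1.
Proof.
have := mu_sqr; have := mu_gt2; rewrite /sg => h1 h2.
by rewrite ltr_norml; apply/andP; split; nra.
Qed.

(** Chosen so that the lines spanned by (1, - mu, stable_slope) and
    (mu, 1, unstable_slope) are invariant; the second is summed along the past. *)
Definition stable_slope c u : R :=
  geom_sum (sg / 2) (fun k => - (c * dwave (iter k bmap u).1) / 2).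
Definition unstable_slope c u : R :=
  geom_sum (2 / mu) (fun k => c * dwave (iter k.+1 binv u).1).

Lemma norm_stable_ratio : `|sg / 2| < 1.
Proof. by have := norm_sg; rewrite normrM [`|2^-1|]gtr0_norm// => ?; lra. Qed.

Lemma unstable_ratio : 0 < 2 / mu < 1.
Proof.
have m2 := mu_gt2; apply/andP; split; first by rewrite divr_gt0//; lra.
by rewrite ltr_pdivrMr; lra.
Qed.

Lemma norm_unstable_ratio : `|2 / mu| < 1.
Proof. by have /andP[m0 m1] := unstable_ratio; rewrite gtr0_norm. Qed.

Lemma ler_stable_term c k u : `|- (c * dwave (iter k bmap u).1) / 2| <= `|c| * om / 2.
Proof.
rewrite normrM normrN normrM [`|2^-1|]gtr0_norm// ler_wpM2r//.
by rewrite ler_wpM2l// ler_dwave.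
Qed.

Lemma ler_unstable_term c k u : `|c * dwave (iter k.+1 binv u).1| <= `|c| * om.
Proof. by rewrite normrM ler_wpM2l// ler_dwave. Qed.

(** Third coordinate of the invariance of the stable line. Solved for the value at [u] it contracts
    by [sg / 2], so iteration runs along the future. *)
Lemma stable_slope_eq c u :
  2 * stable_slope c u + c * dwave u.1 = sg * stable_slope c (bmap u).
Proof.
rewrite {1}/stable_slope (geom_sum_rec norm_stable_ratio (ler_stable_term c^~ u)) /=.
rewrite (_ : (fun k => _) = (fun k => - (c * dwave (iter k bmap (bmap u)).1) / 2)); last first.
  by apply/funext => k; rewrite -iterSr.
rewrite -/(stable_slope c (bmap u)).
by field.
Qed.

(** The analogue for the strong unstable line, solved for the value at [bmap u]: the factor is then
    [2 / mu], and iteration runs along the past. *)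
Lemma unstable_slope_eq c u :
  2 * unstable_slope c u + c * dwave u.1 * mu = mu * unstable_slope c (bmap u).
Proof.
rewrite [in RHS]/unstable_slope.
rewrite (geom_sum_rec norm_unstable_ratio (ler_unstable_term c^~ _)).
rewrite (_ : (fun k => _) = (fun k => c * dwave (iter k.+1 binv u).1)); last first.
  by apply/funext => k; rewrite iterSr bmapK.
rewrite -/(unstable_slope c u) /=.
by field; exact: mu_neq0.
Qed.

Lemma stable_slope_zcongr c u v : zcongr u v -> stable_slope c u = stable_slope c v.
Proof.
move=> uv; rewrite /stable_slope; congr geom_sum; apply/funext => k.
by rewrite (dwave_zcongr (zcongr_bmap k uv)).
Qed.

(** M is unimodular, so a point of T^2 has a single past even though the torus map is not injective;
    hence the strong line depends on the point only. *)
Lemma unstable_slope_zcongr c u v :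
  zcongr u v -> unstable_slope c u = unstable_slope c v.
Proof.
move=> uv; rewrite /unstable_slope; congr geom_sum; apply/funext => k.
by rewrite (dwave_zcongr (zcongr_binv k.+1 uv)).
Qed.

End BaseMap.

(** * Action of the derivative on the invariant frame *)

Section Bundles.
Variables (R : realType) (c : R).
Local Notation E3 := 'rV[R]_3.
Local Notation mu := (mu R).
Local Notation sg := (sg R).
Local Notation F := (skew_map c).

Definition svec (x : E3) : E3 := vec3 ((1, - mu), stable_slope c (base x)).
Definition uvec (x : E3) : E3 := vec3 ((mu, 1), unstable_slope c (base x)).

Definition diffn n (x v : E3) : E3 := 'd (iter n F) x v.

Lemma diffn0 x v : diffn 0 x v = v.
Proof. by rewrite /diffn; have [_] := is_diff_id x; rewrite -[id]/(iter 0 F) => ->. Qed.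

Lemma diffnS n x v : diffn n.+1 x v = diffn 1 (iter n F x) (diffn n x v).
Proof. exact: diff_iter_skewS. Qed.

Lemma diffnZ n k x v : diffn n x (k *: v) = k *: diffn n x v.
Proof. exact: linearZ. Qed.

Lemma diffnD n x v w : diffn n x (v + w) = diffn n x v + diffn n x w.
Proof. exact: linearD. Qed.

Lemma diffn1 x v : diffn 1 x v =
  vec3 ((2 * v ord0 i0 + v ord0 i1, v ord0 i0),
        2 * v ord0 i2 + c * dwave (x ord0 i0) * v ord0 i0).
Proof. by have [_ E] := is_diff_skew c x; exact: (congr1 (fun h => h v) E). Qed.

Lemma diffn1_svec x : diffn 1 x (svec x) = sg *: svec (F x).
Proof.
have ms := mu_sqr R.
rewrite diffn1; apply: row3P; rewrite !(vec3E, mxE) /=.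
- by rewrite /sg; ring.
- by rewrite /sg; ring: ms.
- by rewrite base_skew -stable_slope_eq /base /=; ring.
Qed.

Lemma diffn1_uvec x : diffn 1 x (uvec x) = mu *: uvec (F x).
Proof.
have ms := mu_sqr R.
rewrite diffn1; apply: row3P; rewrite !(vec3E, mxE) /=.
- by ring: ms.
- by ring.
- by rewrite base_skew -unstable_slope_eq /base /=; ring.
Qed.

Lemma diffn1_e3 x : diffn 1 x (e3 R) = 2 *: e3 R.
Proof. by rewrite diffn1; apply: row3P; rewrite !(vec3E, mxE) /=; ring. Qed.

Lemma diffn_svec n x : diffn n x (svec x) = sg ^+ n *: svec (iter n F x).
Proof.
elim: n => [|n ih]; first by rewrite diffn0 expr0 scale1r.
by rewrite diffnS ih diffnZ diffn1_svec scalerA -exprSr.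
Qed.

Lemma diffn_uvec n x : diffn n x (uvec x) = mu ^+ n *: uvec (iter n F x).
Proof.
elim: n => [|n ih]; first by rewrite diffn0 expr0 scale1r.
by rewrite diffnS ih diffnZ diffn1_uvec scalerA -exprSr.
Qed.

Lemma diffn_e3 n x : diffn n x (e3 R) = 2 ^+ n *: e3 R.
Proof.
elim: n => [|n ih]; first by rewrite diffn0 expr0 scale1r.
by rewrite diffnS ih diffnZ diffn1_e3 scalerA -exprSr.
Qed.

End Bundles.

(** * Exponential growth rates *)

Section Exponents.
Variable R : realType.

(** Division by [n] kills the logarithm of the bounded factor [m n]. *)
Lemma growth_rate (lam a b : R) (u m : nat -> R) : 0 < lam -> 0 < a ->
  (forall n, u n = lam ^+ n * m n) -> (forall n, a <= m n <= b) ->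
  (n%:R^-1 * ln (u n)) @[n --> \oo] --> ln lam.
Proof.
move=> lam0 a0 uE mab; pose C := `|ln a| + `|ln b|.
have m0 n : 0 < m n by have /andP[+ _] := mab n; exact: lt_le_trans.
have lnm n : `|ln (m n)| <= C.
  have /andP[am mb] := mab n.
  have la : ln a <= ln (m n) by rewrite ler_ln ?posrE.
  have lb : ln (m n) <= ln b by rewrite ler_ln ?posrE// (lt_le_trans (m0 n)).
  rewrite ler_norml /C; apply/andP; split.
    have := normr_ge0 (ln b); have := ler_norm (- ln a).
    by rewrite normrN => *; lra.
  by have := normr_ge0 (ln a); have := ler_norm (ln b) => *; lra.
apply/cvgrPdist_le => e e0; near=> n.
have n0 : 0 < n%:R :> R by rewrite ltr0n; near: n; exact: nbhs_infty_gt.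
rewrite uE lnM ?posrE ?exprn_gt0// lnXn// mulrDr -[ln lam *+ n]mulr_natl mulrA mulVf ?gt_eqF//.
rewrite mul1r opprD addNKr normrN normrM gtr0_norm ?invr_gt0//.
rewrite mulrC ler_pdivrMr// (le_trans (lnm n))// mulrC -ler_pdivrMr//.
near: n; exact: nbhs_infty_ger.
Unshelve. all: by end_near. Qed.

End Exponents.

(** * Hyperbolic and dominated splitting, and the exponents *)

Section Splitting.
Variables (R : realType) (c : R).
Local Notation E3 := 'rV[R]_3.
Local Notation mu := (mu R).
Local Notation sg := (sg R).
Local Notation e3 := (e3 R).
Local Notation F := (skew_map c).
Local Notation f := (tmap F).
Local Notation svec := (svec c).
Local Notation uvec := (uvec c).
Local Notation diffn := (diffn c).

(** The three fibres are functions of the point rather than of the full orbit, which settles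
    specialness at once. *)
Definition Estab (p : torus R) : {vspace E3} := <[svec (repr p)]>%VS.
Definition Eweak (p : torus R) : {vspace E3} := <[e3]>%VS.
Definition Estrong (p : torus R) : {vspace E3} := <[uvec (repr p)]>%VS.

Lemma svec_repr x : svec (repr (tproj x)) = svec x.
Proof. by rewrite /svec (stable_slope_zcongr _ (zcongr_repr x)). Qed.

Lemma uvec_repr x : uvec (repr (tproj x)) = uvec x.
Proof. by rewrite /uvec (unstable_slope_zcongr _ (zcongr_repr x)). Qed.

Lemma norm_svec_ge1 x : 1 <= `|svec x|.
Proof. by have := ler_coord (svec x) i0; rewrite vec3E normr1. Qed.

Lemma norm_uvec_ge1 x : 1 <= `|uvec x|.
Proof. by have := ler_coord (uvec x) i1; rewrite vec3E normr1. Qed.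

Lemma norm_e3 : `|e3| = 1.
Proof.
apply/le_anti/andP; split; last by have := ler_coord e3 i2; rewrite vec3E normr1.
by apply: ler_norm3; rewrite vec3E /= ?normr0 ?normr1.
Qed.

(** The slopes are bounded by geometric sums. Together with the lower bounds by 1, [K] fixes the
    constants of the estimates below. *)
Lemma bounded_frame : exists K : R, 1 <= K /\
  forall x, `|svec x| <= K /\ `|uvec x| <= K.
Proof.
pose om : R := pi *+ 2.
pose K1 := (`|c| * om / 2) / (1 - `|sg / 2|).
pose K2 := (`|c| * om) / (1 - `|2 / mu|).
have K1P u : `|stable_slope c u| <= K1.
  exact: (geom_sum_le (norm_stable_ratio R) (fun k => ler_stable_term c k u)).
have K2P u : `|unstable_slope c u| <= K2.
  exact: (geom_sum_le (norm_unstable_ratio R) (fun k => ler_unstable_term c k u)).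
have K10 : 0 <= K1 by apply: le_trans (K1P (0, 0)).
have K20 : 0 <= K2 by apply: le_trans (K2P (0, 0)).
have m2 := mu_gt2 R; have m3 := mu_lt3 R.
have mm : `|mu| = mu by rewrite ger0_norm; lra.
exists (3 + K1 + K2); split; first by lra.
move=> x; have s1 := K1P (base x); have s2 := K2P (base x).
split; apply: ler_norm3; rewrite vec3E /= ?normrN ?mm ?normr1; lra.
Qed.

Lemma svec_neq0 x : svec x != 0.
Proof. by rewrite -normr_gt0 (lt_le_trans ltr01)// norm_svec_ge1. Qed.
Lemma uvec_neq0 x : uvec x != 0.
Proof. by rewrite -normr_gt0 (lt_le_trans ltr01)// norm_uvec_ge1. Qed.
Lemma e3_neq0 : e3 != 0.
Proof. by rewrite -normr_gt0 norm_e3. Qed.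

Lemma vlineZ k (v : E3) : k != 0 -> <[k *: v]>%VS = <[v]>%VS.
Proof.
move=> k0; apply/vspaceP => w; apply/vlineP/vlineP => -[l ->].
  by exists (l * k); rewrite scalerA.
by exists (l / k); rewrite scalerA divfK.
Qed.

(** Periodicity of [w] enters because the representative of the image point may differ from [F] of
    the representative by an integer vector. *)
Lemma line_invariant (w : E3 -> E3) (k : R) : k != 0 ->
  (forall x, diffn 1 x (w x) = k *: w (F x)) ->
  (forall x, w (repr (tproj x)) = w x) ->
  invariant_bundle f F (fun xs i => <[w (repr (xs i))]>%VS).
Proof.
move=> k0 wF wr xs fxs i; rewrite limg_line /Dn lfunE.
have -> : 'd (iter 1 F) (repr (xs i)) (w (repr (xs i))) = k *: w (F (repr (xs i))).
  exact: wF.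
by rewrite vlineZ// -fxs /tmap wr.
Qed.

Lemma sg_neq0 : sg != 0.
Proof. by rewrite /sg; have := mu_gt2 R; lra. Qed.

Lemma Estab_invariant : invariant_bundle f F (fun xs i => Estab (xs i)).
Proof. exact: line_invariant sg_neq0 (diffn1_svec c) svec_repr. Qed.

Lemma Eweak_invariant : invariant_bundle f F (fun xs i => Eweak (xs i)).
Proof.
apply: (@line_invariant (fun=> e3) 2) => // x; exact: diffn1_e3.
Qed.

Lemma Estrong_invariant : invariant_bundle f F (fun xs i => Estrong (xs i)).
Proof. exact: line_invariant (mu_neq0 R) (diffn1_uvec c) uvec_repr. Qed.

Lemma invariant_bundleD (E1 E2 : orbit_bundle R) :
  invariant_bundle f F E1 -> invariant_bundle f F E2 ->
  invariant_bundle f F (fun xs i => E1 xs i + E2 xs i)%VS.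
Proof.
by move=> h1 h2 xs fxs i; rewrite limgD h1// h2.
Qed.

Lemma weak_strong_sum p v : v \in (Eweak p + Estrong p)%VS ->
  exists b d, v = b *: e3 + d *: uvec (repr p).
Proof.
by move=> /memv_addP[_ /vlineP[b ->] [_ /vlineP[d ->] ->]]; exists b, d.
Qed.

Lemma splitting_full p : (Estab p + (Eweak p + Estrong p))%VS = fullv.
Proof.
apply/vspaceP => v; rewrite memvf.
pose x := repr p; have ms := mu_sqr R.
have m1 : 1 + mu ^+ 2 != 0 by have := sqr_ge0 mu; lra.
(* (1, - mu) and (mu, 1) are orthogonal, so [d] is an orthogonal projection; [a] and [b] follow from
   the first and last coordinates. *)
pose d := (v ord0 i1 + mu * v ord0 i0) / (1 + mu ^+ 2).
pose a := v ord0 i0 - d * mu.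
pose b := v ord0 i2 - a * stable_slope c (base x) - d * unstable_slope c (base x).
rewrite (_ : v = a *: svec x + (b *: e3 + d *: uvec x)).
  by rewrite !memv_add// memvZ// memv_line.
apply: row3P; rewrite !(vec3E, mxE) /=.
- by rewrite /a; ring.
- by rewrite /a /d; field.
- by rewrite /b; ring.
Qed.

Lemma splitting_direct p : (Estab p :&: (Eweak p + Estrong p))%VS = 0%VS.
Proof.
apply/vspaceP => v; rewrite memv0; apply/idP/eqP => [|->]; last exact: mem0v.
move=> /memv_capP[/vlineP[a ->] /weak_strong_sum[b [d]]].
move=> /rowP E; have := E i0; have := E i1.
rewrite !(vec3E, mxE) /= => E1 E0.
have m2 := mu_gt2 R.
suff -> : a = 0 by rewrite scale0r.
have E0' : a = d * mu by lra.
have : d * (1 + mu ^+ 2) = 0 by move: E1; rewrite E0' expr2 => E1; lra.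
move=> /eqP; rewrite mulf_eq0 => /orP[/eqP d0|]; first by rewrite E0' d0 mul0r.
by have := sqr_ge0 mu; move=> ? /eqP ?; lra.
Qed.

Lemma weak_strong_direct p : (Eweak p :&: Estrong p)%VS = 0%VS.
Proof.
apply/vspaceP => v; rewrite memv0; apply/idP/eqP => [|->]; last exact: mem0v.
move=> /memv_capP[/vlineP[a ->] /vlineP[d]].
move=> /rowP E; have := E i1.
rewrite !(vec3E, mxE) /= => E1; move/rowP : E => ->.
by have -> : d = 0 by [lra]; rewrite scale0r.
Qed.

Lemma norm_diffn_stable n x a :
  `|diffn n x (a *: svec x)| = `|a| * `|sg| ^+ n * `|svec (iter n F x)|.
Proof. by rewrite diffnZ diffn_svec !normrZ normrX mulrA. Qed.

Lemma norm_diffn_weak n x b : `|diffn n x (b *: e3)| = 2 ^+ n * `|b|.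
Proof.
by rewrite diffnZ diffn_e3 !normrZ normrX norm_e3 mulr1 [`|2|]ger0_norm// mulrC.
Qed.

Lemma norm_diffn_strong n x d :
  `|diffn n x (d *: uvec x)| = mu ^+ n * (`|d| * `|uvec (iter n F x)|).
Proof.
have m0 : 0 <= mu by have := mu_gt2 R; lra.
rewrite diffnZ diffn_uvec normrZ normrZ normrX (ger0_norm m0).
exact: mulrCA.
Qed.

Lemma skew_hyperbolic : hyperbolic_splitting f F (fun xs i => Estab (xs i))
  (fun xs i => Eweak (xs i) + Estrong (xs i))%VS.
Proof.
have m2 := mu_gt2 R; have [K [K1 KP]] := bounded_frame.
split.
- exact: Estab_invariant.
- exact: invariant_bundleD Eweak_invariant Estrong_invariant.
- by move=> xs _ i; split; [exact: splitting_full | exact: splitting_direct].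
(* The rate 1/2 serves both sides: [norm_sg] bounds the contraction, and the slower expansion is
   exactly 2. In the constant, 1 + K pays for the weak component and K for the strong one. *)
exists (1 + K + K), 2^-1; split; [by lra | by apply/andP; split; lra |].
move=> xs _ i n; set x := repr (xs i); have KP' := KP (iter n F x).
split=> v; rewrite /Dn -/(diffn n x v).
  move=> /vlineP[a ->]; rewrite -/x norm_diffn_stable normrZ.
  have sn : `|sg| ^+ n <= 2^-1 ^+ n.
    by rewrite lerXn2r// ?nnegrE//; have := norm_sg R; lra.
  have -> : (1 + K + K) * 2^-1 ^+ n * (`|a| * `|svec x|) =
      `|a| * 2^-1 ^+ n * ((1 + K + K) * `|svec x|) by ring.
  have w1 := norm_svec_ge1 x; have [w2 _] := KP'.
  rewrite ler_pM ?mulr_ge0 ?exprn_ge0// ?ler_wpM2l// (le_trans w2)//.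
  by rewrite (le_trans _ (ler_peMr _ w1))//; lra.
move=> /weak_strong_sum[b [d ->]]; rewrite -/x.
set N := `|diffn n x _|.
(* Of [e3] and [uvec] only the latter has a second coordinate, equal to 1, so this coordinate
   isolates [d]; the weak component is then bounded by subtraction. *)
have dN : mu ^+ n * `|d| <= N.
  have := ler_coord (diffn n x (b *: e3 + d *: uvec x)) i1.
  rewrite diffnD !diffnZ diffn_e3 diffn_uvec !(vec3E, mxE) /= !mulr0 add0r mulr1.
  rewrite normrM normrX [`|mu|]ger0_norm; last by lra.
  by rewrite [leLHS]mulrC /N diffnD !diffnZ diffn_e3 diffn_uvec.
have bN : 2 ^+ n * `|b| <= N + K * N.
  rewrite -(norm_diffn_weak n x).
  rewrite (_ : diffn n x (b *: e3) = diffn n x (b *: e3 + d *: uvec x) -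
    diffn n x (d *: uvec x)); last by rewrite diffnD addrK.
  rewrite (le_trans (ler_normB _ _))// lerD2l norm_diffn_strong mulrA mulrC.
  by rewrite ler_pM// ?mulr_ge0 ?exprn_ge0//; [lra | have [] := KP'].
have N0 : 0 <= N by exact: normr_ge0.
have T0 : 0 < 2^-1 ^+ n :> R by rewrite exprn_gt0.
have b1 : `|b| <= 2^-1 ^+ n * (N + K * N).
  by rewrite exprVn ler_pdivlMl// exprn_gt0.
have d1 : `|d| <= 2^-1 ^+ n * N.
  rewrite exprVn ler_pdivlMl ?exprn_gt0// (le_trans _ dN)// ler_wpM2r//.
  by rewrite lerXn2r// ?nnegrE; lra.
have [_ u1] := KP x.
rewrite (le_trans (ler_normD _ _))// !normrZ norm_e3 mulr1.
have -> : (1 + K + K) * 2^-1 ^+ n * N = 2^-1 ^+ n * (N + K * N) + 2^-1 ^+ n * N * K.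
  by ring.
by rewrite lerD// ler_pM.
Qed.

Lemma skew_splitting : wu_su_splitting f F (fun xs i => Estab (xs i))
  (fun xs i => Eweak (xs i)) (fun xs i => Estrong (xs i)).
Proof.
have m2 := mu_gt2 R; have [K [K1 KP]] := bounded_frame.
split.
- exact: skew_hyperbolic.
- exact: Eweak_invariant.
- exact: Estrong_invariant.
- move=> xs _ i; split; last exact: weak_strong_direct.
  + by rewrite dim_vline svec_neq0.
  + by rewrite dim_vline e3_neq0.
  + by rewrite dim_vline uvec_neq0.
(* The ratio is that of the expansion rates; [K] compares the length of [uvec] at the start with its
   length, at least 1, at the end. *)
exists K, (2 / mu); split; [by lra | exact: unstable_ratio |].
move=> xs _ i n v w /vlineP[b ->] /vlineP[d ->].
rewrite /Dn -!/(diffn n _ _) norm_diffn_weak norm_diffn_strong !normrZ norm_e3.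
have [_ uK] := KP (repr (xs i)).
have u1 := norm_uvec_ge1 (iter n F (repr (xs i))).
set u' := `|uvec (iter _ _ _)| in u1 *; set u := `|uvec _| in uK *.
have mn : mu ^+ n != 0 by rewrite expf_neq0// mu_neq0.
have -> : K * (2 / mu) ^+ n * (mu ^+ n * (`|d| * u') * (`|b| * 1)) =
    2 ^+ n * `|b| * (`|d| * (K * u')).
  by rewrite expr_div_n; field.
rewrite ler_wpM2l ?mulr_ge0 ?exprn_ge0// ler_wpM2l// (le_trans uK)//.
by rewrite ler_peMr//; lra.
Qed.

(** A backward orbit chosen in R^3. [Negz n] stands for -(n+1), hence [n.+1] inverse steps. *)
Definition orbit_point (x : E3) (i : int) : E3 :=
  match i with
  | Posz n => iter n F x
  | Negz n => iter n.+1 (skew_inv c) x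
  end.

Lemma full_orbit_through (p : torus R) : exists xs, full_orbit f xs /\ xs 0 = p.
Proof.
exists (fun i => tproj (orbit_point (repr p) i)); split; last exact: tprojK.
move=> i; rewrite -(tmapE (skew_linearization c)); congr tproj.
case: i => [n|[|n]].
- by rewrite -PoszD addn1.
- by rewrite /= skew_invK.
- have -> : Negz n.+1 + 1 = Negz n by rewrite !NegzE -[in LHS]addn1 PoszD opprD addrNK.
  by rewrite /= skew_invK.
Qed.

Lemma weak_exponent p : exponent f F (fun xs i => Eweak (xs i)) p (ln 2).
Proof.
split; first exact: full_orbit_through.
move=> xs _ _ v /vlineP[b ->] b0.
have b0' : 0 < `|b|.
  by rewrite normr_gt0; apply: contraNneq b0 => ->; rewrite scale0r.
apply: (growth_rate (a := `|b|) (b := `|b|) (m := fun=> `|b|)) => // [n|n].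
  exact: norm_diffn_weak.
by rewrite lexx.
Qed.

Lemma strong_exponent p : exponent f F (fun xs i => Estrong (xs i)) p (ln mu).
Proof.
have m2 := mu_gt2 R; have [K [K1 KP]] := bounded_frame.
split; first exact: full_orbit_through.
move=> xs _ -> v /vlineP[d ->] d0.
have d0' : 0 < `|d|.
  by rewrite normr_gt0; apply: contraNneq d0 => ->; rewrite scale0r.
apply: (growth_rate (a := `|d|) (b := `|d| * K)
  (m := fun n => `|d| * `|uvec (iter n F (repr p))|)) => // [|n|n].
- by lra.
- exact: norm_diffn_strong.
- have [_ uK] := KP (iter n F (repr p)).
  by rewrite ler_peMr ?norm_uvec_ge1//= ler_wpM2l.
Qed.

End Splitting.

(** * The Weierstrass-type function and the conjugating shear *)

Section Conjugacy.
Variable R : realType.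
Local Notation E3 := 'rV[R]_3.
Local Notation mu := (mu R).
Local Notation e3 := (e3 R).
Local Notation om := (pi *+ 2 : R).
Implicit Types u v : R * R.

(** The function psi: phi is [wave] / 4, and the weight 2^(-k-1) brings a further factor 1/2. *)
Definition weierstrass u : R :=
  geom_sum 2^-1 (fun k => wave (iter k (@bmap R) u).1 / 8).

Lemma wave_bounds (t : R) : 0 <= wave t <= 2.
Proof.
by rewrite /wave; apply/andP; split; [have := cos_le1 (om * t) | have := cos_geN1 (om * t)]; lra.
Qed.

Lemma norm_half : `|2^-1 : R| < 1.
Proof. by rewrite gtr0_norm//; lra. Qed.

Lemma wave_term_bounds k u : 0 <= wave (iter k (@bmap R) u).1 / 8 <= 4^-1.
Proof. by have /andP[] := wave_bounds (iter k (@bmap R) u).1 => *; apply/andP; split; lra. Qed.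

Lemma ler_wave_term k u : `|wave (iter k (@bmap R) u).1 / 8| <= 4^-1.
Proof. by have /andP[? ?] := wave_term_bounds k u; rewrite ger0_norm. Qed.

Lemma weierstrass_eq u :
  weierstrass u = wave u.1 / 8 + 2^-1 * weierstrass (bmap u).
Proof.
rewrite {1}/weierstrass (geom_sum_rec norm_half (ler_wave_term^~ u)) /=.
congr (_ + _ * geom_sum _ _); apply/funext => k.
by rewrite -iterSr.
Qed.

(** The terms are at most 1/4 before weighting and the ratio is 1/2. The bound 1/2 matters later:
    such a height cannot be shortened by integer translations. *)
Lemma weierstrass_bounds u : 0 <= weierstrass u <= 2^-1.
Proof.
apply/andP; split.
  apply: (geom_sum_ge0 (B := 4^-1)); first by apply/andP; split; lra.
  by move=> k; exact: wave_term_bounds.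
have := geom_sum_le norm_half (ler_wave_term^~ u).
rewrite -/(weierstrass u) [`|2^-1|]gtr0_norm// => h.
rewrite (le_trans (ler_norm _))// (le_trans h)//.
by rewrite (_ : 1 - 2^-1 = 2^-1 :> R); lra.
Qed.

Lemma weierstrass0 : weierstrass (0, 0) = 0.
Proof.
have := weierstrass_eq (0, 0); rewrite /wave /bmap /= !mulr0 addr0 cos0; lra.
Qed.

Lemma weierstrass_zcongr u v : zcongr u v -> weierstrass u = weierstrass v.
Proof.
move=> uv; rewrite /weierstrass; congr geom_sum; apply/funext => k.
by rewrite (wave_zcongr (zcongr_bmap k uv)).
Qed.

Lemma base_iter c k (x : E3) :
  base (iter k (skew_map c) x) = iter k (@bmap R) (base x).
Proof. by elim: k => //= k <-; rewrite base_skew. Qed.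

Lemma wave_continuous : continuous (@wave R).
Proof.
move=> t; apply: cvgB; first exact: cvg_cst.
apply: (@continuous_comp _ _ _ ( *%R om) cos); last exact: continuous_cos.
exact: mulrl_continuous.
Qed.

Lemma weierstrass_continuous : continuous (fun x : E3 => weierstrass (base x)).
Proof.
apply: (geom_sum_continuous norm_half (fun k x => ler_wave_term k (base x))).
move=> k; rewrite (_ : (fun x : E3 => _) =
    (fun x => wave (iter k (skew_map 0) x ord0 i0) / 8)); last first.
  by apply/funext => x; rewrite -(base_iter 0).
have c1 : continuous (fun x : E3 => iter k (skew_map 0) x ord0 i0).
  move=> x; apply: (@continuous_comp _ _ _ (iter k (skew_map 0)) (fun y : E3 => y ord0 i0)).
    exact/differentiable_continuous/differentiable_iter_skew.
  exact: coord_continuous.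
have c2 : continuous (fun x : E3 => wave (iter k (skew_map 0) x ord0 i0)).
  by move=> x; apply: (continuous_comp (c1 x)); exact: wave_continuous.
by move=> x; exact: (cvgMr_tmp (b := 8^-1) (c2 x)).
Qed.

(** [a = 1] is the conjugacy and [a = -1] its inverse, since the base coordinates do not move. *)
Definition shear (a : R) (x : E3) : E3 := x + (a * weierstrass (base x)) *: e3.

Lemma base_shear a x : base (shear a x) = base x.
Proof. by rewrite /base /shear !(mxE, vec3E) /= !mulr0 !addr0. Qed.

Lemma shearK a : cancel (shear a) (shear (- a)).
Proof. by move=> x; rewrite {1}/shear base_shear /shear mulNr scaleNr addrK. Qed.

Lemma shear_linearization a : linearization (shear a) 1%:M.
Proof.
move=> x n; rewrite mulmx1 /shear addrAC; congr (_ + (_ * _) *: _ + _).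
apply: weierstrass_zcongr.
by exists (n ord0 i0), (n ord0 i1); rewrite /base !mxE.
Qed.

Lemma shear_continuous a : continuous (shear a).
Proof.
have c1 : continuous (fun x : E3 => a * weierstrass (base x)).
  by move=> x; exact: (cvgMl_tmp (a := a) (weierstrass_continuous (x:=x))).
have c2 : continuous (fun x : E3 => (a * weierstrass (base x)) *: e3).
  move=> x; apply: (@continuous_comp _ _ _
    (fun x : E3 => a * weierstrass (base x)) ( *:%R^~ e3) x (c1 x)).
  exact: scalel_continuous.
by move=> x; exact: (cvgD cvg_id (c2 x)).
Qed.

(** In the last coordinate this is the functional equation of [weierstrass], with - phi = - [wave] /
    4 as the nonlinear term. *)
Lemma shear_conj x :
  shear 1 (skew_map 0 x) = skew_map (- 4^-1) (shear 1 x).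
Proof.
have := weierstrass_eq (base x); rewrite /shear base_skew /= => E.
apply: row3P; rewrite !(vec3E, mxE) /= ?vec3E /=; [by ring|by ring|].
by rewrite mulr0 addr0 E; field.
Qed.

Lemma tmap_comp (F G : E3 -> E3) (A : 'M[int]_3) p : linearization F A ->
  tmap F (tmap G p) = tproj (F (G (repr p))).
Proof. by move=> FA; rewrite /(tmap G) -(tmapE FA). Qed.

Lemma tmap_shearK a : cancel (tmap (shear a)) (tmap (shear (- a))).
Proof.
by move=> p; rewrite (tmap_comp _ _ (shear_linearization _)) shearK tprojK.
Qed.

Lemma shear_homeo a : homeo (tmap (shear a)).
Proof.
split; first exact: (tmap_continuous (shear_linearization a) (@shear_continuous a)).
exists (tmap (shear (- a))); split; last by rewrite -{2}(opprK a); exact: tmap_shearK.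
  exact: (tmap_continuous (shear_linearization (- a)) (@shear_continuous (- a))).
exact: tmap_shearK.
Qed.

Lemma tmap_shear_conj p : tmap (shear 1) (tmap (skew_map 0) p) =
  tmap (skew_map (- 4^-1)) (tmap (shear 1) p).
Proof.
rewrite (tmap_comp _ _ (shear_linearization _)).
by rewrite (tmap_comp _ _ (skew_linearization _)) shear_conj.
Qed.

End Conjugacy.

(** * Failure of the Lipschitz and C^1 properties *)

Section Irregularity.
Variable R : realType.
Local Notation E3 := 'rV[R]_3.
Local Notation mu := (mu R).
Local Notation e3 := (e3 R).
Local Notation H := (shear (1 : R)).
Local Notation h := (tmap H).

(** [wdir] is an eigenvector of [bmap] for [mu], so [bmap] sends [wtime n.+1 *: wdir]
    to [wtime n *: wdir]; at [n = 0] the first coordinate is 1/2, where [wave]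
    is maximal. *)
Definition wdir : E3 := vec3 ((1, mu^-1), 0).
Definition wtime (n : nat) : R := 2^-1 * mu^-1 ^+ n.

Lemma wtime_gt0 n : 0 < wtime n.
Proof.
have m2 := mu_gt2 R.
by rewrite /wtime mulr_gt0// exprn_gt0// invr_gt0; lra.
Qed.

Lemma bmap_wtime n : bmap (base (wtime n.+1 *: wdir)) = base (wtime n *: wdir).
Proof.
have ms := mu_sqr R; have m0 := mu_neq0 R.
rewrite /base /bmap !(mxE, vec3E) /= /wtime exprS.
have e : 2 + mu^-1 = mu.
  by apply: (mulIf m0); rewrite mulrDl mulVf// -expr2 ms.
congr (_, _); last by rewrite mulr1; ring.
have -> : 2 * (2^-1 * (mu^-1 * mu^-1 ^+ n) * 1) + 2^-1 * (mu^-1 * mu^-1 ^+ n) * mu^-1 =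
  2^-1 * mu^-1 ^+ n * (mu^-1 * (2 + mu^-1)) by ring.
by rewrite e mulVf.
Qed.

(** As [wave] is nonnegative, each step loses at most a factor 2; the start is the maximal value 2
    of [wave] divided by 8. *)
Lemma weierstrass_lower n : 4^-1 * 2^-1 ^+ n <= weierstrass (base (wtime n *: wdir)).
Proof.
elim: n => [|n ih].
  rewrite weierstrass_eq expr0 mulr1.
  have /andP[w0 _] := weierstrass_bounds (bmap (base (wtime 0 *: wdir))).
  have -> : wave (base (wtime 0 *: wdir)).1 = 2.
    rewrite /wave /base /= !(mxE, vec3E) /= /wtime expr0 !mulr1.
    by rewrite (_ : pi *+ 2 * 2^-1 = pi :> R) ?cospi ?opprK//; field.
  by lra.
rewrite weierstrass_eq bmap_wtime.
have /andP[w0 _] := wave_bounds (base (wtime n.+1 *: wdir)).1.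
by rewrite exprS; lra.
Qed.

(** The bound would force 1/4 <= (L / 2) (2 / mu)^n, whose right side tends to 0. Refuting even an
    eventual bound lets this serve for the derivative at 0. *)
Lemma weierstrass_not_linear_bound (L : R) :
  ~ \forall n \near \oo, weierstrass (base (wtime n *: wdir)) <= L * wtime n.
Proof.
have m2 := mu_gt2 R; have m0 := mu_neq0 R.
have cv : (fun n => L * 2^-1 * (2 / mu) ^+ n) @ \oo --> (0 : R).
  rewrite -[0](mulr0 (L * 2^-1)).
  by apply: cvgMl_tmp; apply: cvg_expr; exact: norm_unstable_ratio.
move=> LP.
have [n] : exists n, weierstrass (base (wtime n *: wdir)) <= L * wtime n /\
    L * 2^-1 * (2 / mu) ^+ n < 4^-1.
  suff : \forall n \near \oo, weierstrass (base (wtime n *: wdir)) <= L * wtime n /\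
    L * 2^-1 * (2 / mu) ^+ n < 4^-1 by move/filter_ex.
  near=> n; split; first by near: n.
  near: n; move/cvgrPdist_lt : cv => /(_ 4^-1) []; first by rewrite invr_gt0.
  move=> N _ NP; exists N => // n /NP /=.
  by rewrite sub0r normrN; exact: le_lt_trans (ler_norm _).
move=> [/(le_trans (weierstrass_lower n))].
have p2 : 0 < 2^-1 ^+ n :> R by rewrite exprn_gt0.
have -> : L * wtime n = L * 2^-1 * (2 / mu) ^+ n * 2^-1 ^+ n.
  have mn : mu ^+ n != 0 by rewrite expf_neq0.
  have tn : 2 ^+ n != 0 :> R by rewrite expf_neq0.
  by rewrite /wtime expr_div_n !exprVn; field; rewrite tn mn.
by rewrite ler_pM2r// => a b; lra.
Unshelve. all: by end_near. Qed.

Lemma norm_wdir : `|wdir| = 1.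
Proof.
have m2 := mu_gt2 R.
apply/le_anti/andP; split; last by have := ler_coord wdir i0; rewrite vec3E normr1.
apply: ler_norm3; rewrite vec3E /= ?normr0 ?normr1//.
by rewrite gtr0_norm ?invr_gt0 ?invf_le1//; lra.
Qed.

Lemma shear0 : H 0 = 0.
Proof.
by rewrite /shear /base !mxE weierstrass0 mulr0 scale0r addr0.
Qed.

Lemma shear_coord2 (x : E3) : H x ord0 i2 = x ord0 i2 + weierstrass (base x).
Proof. by rewrite /shear !(mxE, vec3E) /= mul1r mulr1. Qed.

Lemma tdist_ge0 (p q : torus R) : 0 <= tdist p q.
Proof.
apply: lb_le_inf; last by move=> _ [x [y [_ _ ->]]].
by exists `|repr p - repr q|, (repr p), (repr q); rewrite !tprojK.
Qed.

Lemma tdist_le (x y : E3) : tdist (tproj x) (tproj y) <= `|x - y|.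
Proof.
apply: ge_inf; last by exists x, y.
by exists 0 => _ [x' [y' [_ _ ->]]].
Qed.

(** Passing to another lift cannot shorten a height in [0, 1/2]; this handles the infimum in
    [tdist]. *)
Lemma ler_norm_shift (t : R) (z : int) : 0 <= t <= 2^-1 -> t <= `|t + z%:~R|.
Proof.
move=> /andP[t0 t2]; case: (ltrP z 0) => z0.
  have : (z%:~R : R) <= (-1)%:~R by rewrite ler_int; lia.
  rewrite rmorphN1 => z1; by rewrite ler0_norm; lra.
have : 0 <= z%:~R :> R by rewrite ler0z.
by move=> z1; rewrite ger0_norm; lra.
Qed.

Lemma shear_not_lipschitz : ~ torus_lipschitz h.
Proof.
move=> [L LP]; apply: (@weierstrass_not_linear_bound `|L|).
apply: nearW => n.
have hE x : h (tproj x) = tproj (H x) by rewrite (tmapE (shear_linearization _)).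
have := LP (tproj (wtime n *: wdir)) (tproj 0); rewrite !hE shear0 => le1.
have le2 : tdist (tproj (wtime n *: wdir)) (tproj 0) <= wtime n.
  rewrite (le_trans (tdist_le _ _))// subr0 normrZ norm_wdir mulr1.
  by rewrite gtr0_norm ?wtime_gt0.
apply: (@le_trans _ _ (tdist (tproj (H (wtime n *: wdir))) (tproj 0))); last first.
  rewrite (le_trans le1)// (@le_trans _ _ (`|L| * tdist (tproj (wtime n *: wdir)) (tproj 0)))//.
    by rewrite ler_wpM2r ?tdist_ge0// ler_norm.
  by rewrite ler_wpM2l.
apply: lb_le_inf; first by exists `|H (wtime n *: wdir) - 0|, (H (wtime n *: wdir)), 0.
move=> _ [x [y [/tproj_inj[m ->] /tproj_inj[m' ->] ->]]].
apply: le_trans (ler_coord _ i2).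
have := shear_coord2 (wtime n *: wdir); move: (H _) => w wE.
rewrite add0r !mxE wE !mxE /= mulr0 add0r -addrA -rmorphB.
exact: ler_norm_shift (weierstrass_bounds _).
Qed.

Lemma int_coord_eq (x y : E3) : (forall i, x ord0 i - y ord0 i \is a Num.int) ->
  `|x - y| < 1 -> x = y.
Proof.
move=> xi xy; apply/rowP => i; apply/eqP; rewrite -subr_eq0; apply/eqP.
have /intrP[z E] := xi i.
have : `|(x - y) ord0 i| < 1 by exact: le_lt_trans (ler_coord _ _) xy.
rewrite !mxE E -intr_norm -[1]/(1%:~R) ltr_int.
by move=> z1; suff -> : z = 0 by []; lia.
Qed.

(** A local C^1 lift differs from [shear 1] by an integer vector, constant near 0 by continuity; the
    shear would then have a derivative along [wdir] at 0, hence a linear bound there. *)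
Lemma shear_not_C1 : ~ torus_Ck 1 h.
Proof.
move=> /(_ 0) [U [G [oU U0 [Gd _] GE]]].
have dG : differentiable G 0 by apply: Gd.
have cG : {for 0, continuous G} by exact: differentiable_continuous.
have cH : {for 0, continuous H} by exact: shear_continuous.
have GH y : U y -> forall i, (G y - H y) ord0 i \is a Num.int.
  move=> /GE; rewrite -(tmapE (shear_linearization _)) => /tproj_inj[m ->] i.
  by rewrite addrAC subrr add0r !mxE intr_int.
have near1 : \forall y \near (0 : E3), G y - H y = G 0 - H 0.
  have cD : (fun y => G y - H y) @ (0 : E3) --> G 0 - H 0 by exact: cvgB cG cH.
  move/cvgrPdist_lt : cD => /(_ 1 ltr01) cD.
  near=> y; apply/esym/int_coord_eq; last by near: y.
  have Uy : U y by near: y; exact: open_nbhs_nbhs.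
  by move=> i; rewrite rpredB// GH.
have /cvg_ex[/= l lP] : derivable G 0 wdir by exact: diff_derivable.
move/cvgrPdist_lt : lP => /(_ 1 ltr01) lP.
(* The difference quotient tends to [l], so its norm is eventually below [|l| + 1]. *)
have nearG : \forall t \near (0 : R)^',
    `|G (t *: wdir) - G 0| <= (`|l| + 1) * `|t|.
  near=> t.
  have t0 : t != 0 by near: t; exact: nbhs_dnbhs_neq.
  have : `|l - t^-1 *: (G (t *: wdir + 0) - G 0)| < 1 by near: t.
  rewrite addr0; set D := G _ - _ => lt.
  rewrite -ler_pdivrMr ?normr_gt0// mulrC -normfV -normrZ.
  rewrite (_ : t^-1 *: D = l - (l - t^-1 *: D)); last by rewrite opprB addrC subrK.
  by rewrite (le_trans (ler_normB _ _))// lerD2l ltW.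
apply: (@weierstrass_not_linear_bound (`|l| + 1)).
have m2 := mu_gt2 R.
have w0 : wtime n @[n --> \oo] --> (0 : R).
  rewrite -[0](mulr0 2^-1); apply: cvgMl_tmp; apply: cvg_expr.
  by rewrite gtr0_norm ?invr_gt0 ?invf_lt1; lra.
(* The times [wtime n] are nonzero, so they also converge in the punctured filter of the difference
   quotient. *)
have wt0 : wtime n @[n --> \oo] --> (0 : R)^'.
  move=> A A0; have {}A0 : \forall n \near \oo, wtime n != 0 -> A (wtime n) by exact: w0 A0.
  change (\forall n \near \oo, A (wtime n)).
  by apply: filterS A0 => n; apply; exact: lt0r_neq0 (wtime_gt0 n).
have wtw : wtime n *: wdir @[n --> \oo] --> (0 : E3).
  rewrite -(scale0r wdir).
  exact: (cvg_comp _ _ w0 (scalel_continuous (x := wdir) (x0 := 0))).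
have g1n : \forall n \near \oo,
  `|G (wtime n *: wdir) - G 0| <= (`|l| + 1) * `|wtime n| by exact: wt0 nearG.
have g2n : \forall n \near \oo,
  G (wtime n *: wdir) - H (wtime n *: wdir) = G 0 - H 0 by exact: wtw near1.
near=> n.
have g1 : `|G (wtime n *: wdir) - G 0| <= (`|l| + 1) * `|wtime n|.
  by near: n.
have g2 : G (wtime n *: wdir) - H (wtime n *: wdir) = G 0 - H 0.
  by near: n.
rewrite [in `|wtime n|]gtr0_norm ?wtime_gt0// in g1.
apply: le_trans g1.
have -> : G (wtime n *: wdir) - G 0 = H (wtime n *: wdir).
  by move: g2; rewrite shear0 subr0 => /eqP; rewrite subr_eq addrC => /eqP ->; rewrite addrK.
apply: le_trans (ler_coord _ i2).
by rewrite shear_coord2 mxE vec3E /= mulr0 add0r ler_norm.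
Unshelve. all: by end_near. Qed.

End Irregularity.

(** * Lebesgue measure under translation, on the line and the circle *)

Section Translation.
Variable R : realType.
Local Notation leb := (@lebesgue_measure R).

Lemma measurable_translate (c : R) :
  measurable_fun setT ((fun x => x + c) : measurableTypeR R -> measurableTypeR R).
Proof.
apply: measurable_realfun.continuous_measurable_fun => x.
exact: (cvgD cvg_id (cvg_cst _)).
Qed.

(** Lebesgue measure is determined by its values on half-open intervals, whose length a translation
    keeps. *)
Lemma lebesgue_measure_translate (c : R) (X : set R) : measurable X ->
  pushforward leb ((fun x => x + c) : _ -> measurableTypeR R) X = leb X.
Proof.
move=> mX; apply/esym/lebesgue_measure_unique => //=.
  exact: measurable_translate.
move=> mt _ [[a b]] _ <-; rewrite /pushforward.
rewrite (_ : _ @^-1` _ = `]a - c, b - c]%classic); last first.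
  by apply/seteqP; split => x /=; rewrite !in_itv/= ltrBlDr lerBrDr.
rewrite !lebesgue_measure_itv/= !lte_fin ltrD2r -!EFinD.
by case: ifP => // _; congr (_%:E); ring.
Qed.

(** The shift carries [0, 1) to [c, 1 + c); the part beyond 1 returns to [0, c) by periodicity. *)
Lemma lebesgue_measure_periodic (E : set R) (c : R) : measurable E ->
  (forall x, E (x + 1) <-> E x) -> 0 <= c <= 1 ->
  leb ([set x | E (x + c)] `&` `[0, 1[) = leb (E `&` `[0, 1[).
Proof.
move=> mE pE /andP[c0 c1].
have mi a b : measurable (E `&` `[a, b[) by apply: measurableI => //; exact: measurable_itv.
have tr d a b : leb ([set x | E (x + d)] `&` `[a, b[) = leb (E `&` `[a + d, b + d[).
  rewrite -(@lebesgue_measure_translate d (E `&` `[a + d, b + d[))// /pushforward.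
  congr (lebesgue_measure _).
  by apply/seteqP; split => x /=; rewrite !in_itv/= lerD2r ltrD2r.
have split a b d : a <= b -> b <= d ->
    leb (E `&` `[a, d[) = (leb (E `&` `[a, b[) + leb (E `&` `[b, d[))%E.
  move=> ab bd; rewrite -measureU//.
    rewrite -setIUr; congr (leb (E `&` _)).
    apply/seteqP; split => x /=; rewrite !in_itv/=.
      by move=> /andP[ax xd]; case: (ltP x b) => xb; [left|right]; apply/andP.
    move=> [/andP[ax xb]|/andP[bx xd]]; apply/andP; split => //.
      exact: lt_le_trans xb bd.
    exact: le_trans ab bx.
  1,2: exact: mi.
  apply/seteqP; split => x //= -[[_ +] [_]].
  by rewrite !in_itv/= => /andP[_ xb] /andP[bx _]; move: (lt_le_trans xb bx); rewrite ltxx.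
rewrite tr add0r (split c 1 (1 + c))//; last by lra.
rewrite (split 0 c 1)// addeC; congr (_ + _)%E.
rewrite -[in RHS](_ : [set x | E (x + 1)] = E); last by apply/seteqP; split => x /= /pE.
by rewrite tr add0r addrC.
Qed.

End Translation.

(** * The shear preserves Haar measure *)

Section HaarInvariance.
Variable R : realType.

Lemma tpar_add1 (u : R * R) (z : R) : tpar (u, z + 1) = tpar (u, z).
Proof.
rewrite /tpar (_ : vec3 (u, z + 1) = vec3 (u, z) +
  map_mx intr (\row_(i < 3) (i == i2)%:R : 'rV[int]_3)); first exact: tproj_zvec.
by apply: row3P; rewrite !(vec3E, mxE) /=; ring.
Qed.

Lemma shear_tpar a (u : R * R) (z : R) :
  tmap (shear a) (tpar (u, z)) = tpar (u, z + a * weierstrass u).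
Proof.
rewrite /tpar -(tmapE (shear_linearization a)); congr tproj.
case: u => u1 u2; rewrite /shear /base !vec3E /=.
by apply: row3P; rewrite !(vec3E, mxE) /= ; ring.
Qed.

(** By Fubini: on the circle over [u] the shear is the translation by [weierstrass u], so the
    sections keep their measure. *)
Lemma haar_shear (A : set (torus R)) : measurable A ->
  haar (tmap (shear 1) @^-1` A) = haar A.
Proof.
move=> mA.
have {}mA : measurable (@tpar R @^-1` A).
  by have : torus_measurable A := mA; rewrite /torus_measurable /image_set_system /= setTI.
rewrite /haar /pushforward /mrestr /lebesgue3.
apply: eq_integral => u _ /=.
have [u01|u01] := pselect ((`[0, 1[ `*` `[0, 1[) u); last first.
  congr (lebesgue_measure _); apply/seteqP.
  by split => z /xsectionP[_ [/= /u01]].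
pose E := xsection (@tpar R @^-1` A) u.
have xE (B : set (torus R)) : xsection (@tpar R @^-1` B `&` @unit_cube R) u =
    [set z | B (tpar (u, z))] `&` `[0, 1[.
  apply/seteqP; split => z.
    by move=> /xsectionP[Bz [_ /= z01]].
  by move=> [Bz z01]; apply/xsectionP.
rewrite !xE.
have EE : E = [set z | A (tpar (u, z))].
  by apply/seteqP; split => [z /xsectionP|z Az]; [|apply/xsectionP].
rewrite -EE -(@lebesgue_measure_periodic _ E (weierstrass u)).
- congr (lebesgue_measure (_ `&` _)); apply/seteqP; split => z /=.
    by rewrite EE shear_tpar mul1r.
  by rewrite EE shear_tpar mul1r.
- exact: measurable_xsection.
- by move=> z; rewrite EE /= tpar_add1.
- by have /andP[? ?] := weierstrass_bounds u; apply/andP; split; lra.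
Qed.

Lemma haar_set0 : @haar R set0 = 0%E.
Proof.
rewrite /haar /pushforward preimage_set0 /mrestr set0I.
by rewrite /lebesgue3 /lebesgue2 measure0.
Qed.

End HaarInvariance.

(** * The flat unstable leaf through the origin *)

Section UnstableLeaf.
Variables (R : realType) (c : R).
Local Notation E3 := 'rV[R]_3.
Local Notation mu := (mu R).
Local Notation Eu := (fun p => Eweak p + Estrong c p)%VS.

(** The plane projecting onto the leaf through [tproj 0]; it is flat although the strong direction
    varies inside it. *)
Definition leaf_plane (t : R * R) : E3 := t.1 *: vec3 ((mu, 1), 0) + t.2 *: e3 R.

Lemma leaf_plane_linear : linear leaf_plane.
Proof.
move=> k [a1 a2] [b1 b2]; rewrite /leaf_plane /=.
by rewrite !scalerDl !scalerDr -!scalerA addrACA.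
Qed.

HB.instance Definition _ := GRing.isLinear.Build _ _ _ _ leaf_plane leaf_plane_linear.

Lemma leaf_plane_continuous : continuous leaf_plane.
Proof.
have c1 v : continuous (fun t : R * R => t.1 *: v : E3).
  move=> t; apply: (@continuous_comp _ _ _ fst (fun k : R => k *: v : E3)); first exact: cvg_fst.
  exact: scalel_continuous.
have c2 v : continuous (fun t : R * R => t.2 *: v : E3).
  move=> t; apply: (@continuous_comp _ _ _ snd (fun k : R => k *: v : E3)); first exact: cvg_snd.
  exact: scalel_continuous.
by move=> t; exact: (cvgD (c1 _ t) (c2 _ t)).
Qed.

Lemma leaf_plane_differentiable t : differentiable leaf_plane t.
Proof.
exact: (@linear_differentiable R (R * R)%type E3 leaf_plane t leaf_plane_continuous).
Qed.

Lemma leaf_plane_derive t v : 'D_v leaf_plane t = leaf_plane v.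
Proof.
rewrite deriveE; last exact: leaf_plane_differentiable.
exact: (congr1 (fun h => h v) (@diff_lin R (R * R)%type E3 leaf_plane t leaf_plane_continuous)).
Qed.

(** The slope of [uvec] only adds a multiple of [e3], so [e3] and [uvec] span the same plane at
    every point. *)
Lemma leaf_plane_Eu t p : leaf_plane t \in Eu p.
Proof.
rewrite (_ : leaf_plane t =
    (t.2 - t.1 * unstable_slope c (base (repr p))) *: e3 R + t.1 *: uvec c (repr p)).
  by rewrite memv_add// memvZ// memv_line.
by apply: row3P; rewrite !(vec3E, mxE) /=; ring.
Qed.

Lemma leaf_plane_leaf t : unstable_leaf Eu (tproj 0) (tproj (leaf_plane t)).
Proof.
have dl x : is_diff x ( *:%R^~ (leaf_plane t) : R -> E3) ( *:%R^~ (leaf_plane t)).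
  exact: is_diff_scalel.
have D v x : 'D_v ( *:%R^~ (leaf_plane t) : R -> E3) x = v *: leaf_plane t.
  have [d1 d2] := dl x; rewrite deriveE//.
  exact: (congr1 (fun h => h v) d2).
exists ( *:%R^~ (leaf_plane t)); split.
- split; first by move=> x _; have [] := dl x.
  move=> v; rewrite (_ : (fun x => _) = fun=> v *: leaf_plane t).
    by move=> x _; exact: cst_continuous.
  by apply/funext => x; exact: D.
- by move=> x; rewrite derive1E D scale1r; exact: leaf_plane_Eu.
- by rewrite scale0r.
- by rewrite scale1r.
Qed.

Lemma leaf_plane_density t : area_density leaf_plane t = Num.sqrt (mu ^+ 2 + 1).
Proof.
rewrite /area_density !leaf_plane_derive /dotp; congr Num.sqrt.
rewrite !big_ord_recl !big_ord0 !mxE /=; ring.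
Qed.

Lemma leaf_plane_chart :
  leaf_chart (unstable_leaf Eu (tproj 0)) (`]0, 1[ `*` `]0, 1[) leaf_plane.
Proof.
split.
- rewrite (_ : _ `*` _ = fst @^-1` `]0, 1[ `&` snd @^-1` `]0, 1[)//.
  have oI : open (`]0, 1[%classic : set R) by exact: interval_open.
  apply: openI; apply: open_comp => // t _; [exact: cvg_fst | exact: cvg_snd].
- split; first by move=> x _; exact: leaf_plane_differentiable.
  move=> v x _; rewrite (_ : (fun x => _) = fun=> leaf_plane v).
    exact: cst_continuous.
  by apply/funext => y; exact: leaf_plane_derive.
- move=> t _; rewrite leaf_plane_density gt_eqF// sqrtr_gt0.
  by have := sqr_ge0 mu; lra.
- move=> t t'; rewrite !inE /= !in_itv /=.
  move=> [/andP[a1 a2] /andP[b1 b2]] [/andP[a1' a2'] /andP[b1' b2']].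
  (* In the second and third coordinates, which are the two parameters, the points differ by
     integers and by less than 1. *)
  move=> /tproj_inj[m E].
  have m0 i : `|(m ord0 i)%:~R : R| < 1 -> (m ord0 i)%:~R = 0 :> R.
    rewrite -intr_norm -[1]/(1%:~R) ltr_int => h.
    by rewrite (_ : m ord0 i = 0)//; lia.
  have E1 := congr1 (fun x : E3 => x ord0 i1) E.
  have E2 := congr1 (fun x : E3 => x ord0 i2) E.
  move: E1 E2; rewrite !mxE /= !mulr1 !mulr0 !addr0 !add0r => E1 E2.
  have z1 : (m ord0 i1)%:~R = 0 :> R by apply: m0; rewrite ltr_norml; apply/andP; split; lra.
  have z2 : (m ord0 i2)%:~R = 0 :> R by apply: m0; rewrite ltr_norml; apply/andP; split; lra.
  by case: t t' E1 E2 {a1 a2 b1 b2 a1' a2' b1' b2' E} => [t1 t2] [t1' t2'] /=;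
     rewrite z1 z2 !addr0 => -> ->.
- by move=> t _; exact: leaf_plane_leaf.
Qed.

(** The chart on the open unit square already contributes its constant area density. *)
Lemma leaf_measure_gt0 (S : set (torus R)) : (forall p, S p) ->
  (0 < leaf_measure (unstable_leaf Eu (tproj 0))
         (S `&` unstable_leaf Eu (tproj 0)))%E.
Proof.
move=> ST; pose D : R := Num.sqrt (mu ^+ 2 + 1).
have D0 : 0 < D by rewrite sqrtr_gt0; have := sqr_ge0 mu; lra.
apply: (@lt_le_trans _ _ D%:E); first by rewrite lte_fin.
apply: ereal_sup_ubound; exists (`]0, 1[ `*` `]0, 1[), leaf_plane.
split; first exact: leaf_plane_chart.
rewrite (_ : _ `&` [set t | _] = `]0, 1[ `*` `]0, 1[); last first.
  apply/seteqP; split => [t []//|t Ut]; split => //.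
  by split; [exact: ST | exact: leaf_plane_leaf].
under eq_integral do rewrite leaf_plane_density.
rewrite integral_cst; last by apply: measurableX; exact: measurable_itv.
have E1 : (lebesgue2 (`]0%R, (1 : R)%R[ `*` `]0%R, 1%R[) = 1)%E.
  rewrite /lebesgue2 product_measure1E//=.
  by rewrite lebesgue_measure_itv/= lte_fin ltr01 sube0 mule1.
transitivity (D%:E * lebesgue2 (`]0%R, (1 : R)%R[ `*` `]0%R, 1%R[))%E => //.
by rewrite E1 mule1.
Qed.

End UnstableLeaf.

(** * Smoothness and the Anosov property *)

Section SkewAnosov.
Variables (R : realType) (c : R).

Lemma skew_smooth : torus_smooth (tmap (skew_map c)).
Proof.
move=> k x; exists setT, (skew_map c); split => //.
- exact: openT.
- exact: skew_Ck.
- by move=> y _; rewrite (tmapE (skew_linearization c)).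
Qed.

(** The lift is a global diffeomorphism of R^3, so the domain [setT] serves at every point. *)
Lemma skew_local_diffeo : torus_local_diffeo (tmap (skew_map c)).
Proof.
have imT : skew_map c @` setT = setT.
  by apply/seteqP; split => // y _; exists (skew_inv c y) => //; exact: skew_invK.
move=> x; exists setT, (skew_map c), (skew_inv c); rewrite imT; split.
- by split => //; exact: openT.
- exact: skew_Ck.
- by move=> y _; rewrite (tmapE (skew_linearization c)).
- by split; [exact: openT | exact: skew_inv_Ck].
- by move=> y _; exact: skewK.
Qed.

Lemma skew_anosov : anosov (tmap (skew_map c)) (skew_map c).
Proof.
split; first exact: skew_local_diffeo.
exists (fun xs i => Estab c (xs i)), (fun xs i => Eweak (xs i) + Estrong c (xs i))%VS.
exact: skew_hyperbolic.
Qed.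

End SkewAnosov.

Theorem theorem2 (R : realType) :
  exists (f h : torus R -> torus R) (F : 'rV[R]_3 -> 'rV[R]_3) (A : 'M[int]_3),
  exists (EsA EwuA EsuA : torus R -> {vspace 'rV[R]_3}),
  exists (Es Ewu Esu : orbit_bundle R) (Eu : torus R -> {vspace 'rV[R]_3}),
  exists (lwu lsu : R),
  (is_lift F f /\ torus_smooth f /\ anosov f F) /\
  linearization F A /\
  wu_su_splitting (linear_endo A) (linear_lift A)
    (fun xs i => EsA (xs i)) (fun xs i => EwuA (xs i)) (fun xs i => EsuA (xs i)) /\
  wu_su_splitting f F Es Ewu Esu /\ special f Ewu Esu Eu /\
  (homeo h /\ forall p, h (linear_endo A p) = f (h p)) /\
  {ae pushforward (@haar R) h,
    forall p, exponent f F Ewu p lwu /\ exponent f F Esu p lsu} /\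
  (exists p0 : torus R,
    (0 < leaf_measure (unstable_leaf Eu p0)
           (Zset f F Ewu Esu (lwu + lsu)%R `&` unstable_leaf Eu p0))%E) /\
  pushforward (@haar R) h `<< @haar R /\
  ~ torus_Ck 1 h /\
  ~ torus_lipschitz h.
Proof.
pose c : R := - 4^-1.
have linE : linear_endo (R := R) skew_mx = tmap (skew_map 0).
  by rewrite -skew_linear_lift.
exists (tmap (skew_map c)), (tmap (shear 1)), (skew_map c), skew_mx.
exists (Estab 0), (@Eweak R), (Estrong 0).
exists (fun xs i => Estab c (xs i)), (fun xs i => Eweak (xs i)).
exists (fun xs i => Estrong c (xs i)), (fun p => Eweak p + Estrong c p)%VS.
exists (ln 2), (ln (mu R)).
split; [split; [|split] | split; [|split; [|split; [|split; [|split; [split|split; [|split]]]]]]].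
- split; first exact: skew_continuous.
  by move=> x; rewrite (tmapE (skew_linearization c)).
- exact: skew_smooth.
- exact: skew_anosov.
- exact: skew_linearization.
(* The linear map is the member [c = 0] of the family, so the same splitting applies. *)
- by rewrite linE skew_linear_lift; exact: skew_splitting.
- exact: skew_splitting.
- by [].
- exact: shear_homeo.
- by move=> p; rewrite linE; exact: tmap_shear_conj.
(* The exponents are constant over all points, so the exceptional set is empty. *)
- exists set0; split; [exact: measurable0 | exact: haar_set0 |].
  by move=> p; apply; split; [exact: weak_exponent | exact: strong_exponent].
- exists (tproj 0); apply: leaf_measure_gt0 => p.
  exists (ln 2), (ln (mu R)).
  by split; [exact: weak_exponent | exact: strong_exponent |].
- split; [|split; [exact: shear_not_C1 | exact: shear_not_lipschitz]].
  (* As the shear preserves Haar measure, the pushforward has the same null sets. *)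
  move=> N N0 A mA AN.
  by rewrite /(pushforward _ _) haar_shear//; exact: N0.
Qed.
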